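(* Let $d\in\mathbb N$, $1\le q<p<\infty$, $1\le\theta\le\infty$, $\beta:=1/q-1/p$ and $r>\beta$. For any recovering operator $\Psi(\cdot,X_m)$ with respect to an $(n,n-1)$-net $X_m$ we have $$ \Psi(\mathbf B^r_{q,\theta},X_m)_p \gg 2^{-n(r-\beta)}n^{(d-1)(1/p-1/\theta)}. $$
   Context: $\mathbb T^d=[0,2\pi)^d$ (functions are $2\pi$-periodic in each variable) carries the normalized Lebesgue measure $(2\pi)^{-d}d\mathbf x$; $\|\cdot\|_p$ is the norm of $L_p(\mathbb T^d)$ and $\hat f(\mathbf k)=(2\pi)^{-d}\int_{\mathbb T^d}f(\mathbf x)e^{-i(\mathbf k,\mathbf x)}d\mathbf x$. A recovering operator is given by points $X_m=\{\xi^j\}_{j=1}^m\subset\mathbb T^d$ and functions $\psi_1,\dots,\psi_m\in L_p(\mathbb T^d)$: $\Psi(f,X_m):=\sum_{j=1}^mf(\xi^j)\psi_j(\mathbf x)$. For a class $\mathbf W$, $\Psi(\mathbf W,X_m)_p:=\sup_{f\in\mathbf W}\|f-\Psi(f,X_m)\|_p$, the supremum being over continuous $f\in\mathbf W$ (so that point values make sense). For $\mathbf s\in\mathbb N_0^d$ ($\mathbb N_0=\{0,1,2,\dots\}$, $\|\mathbf s\|_1=s_1+\dots+s_d$) put $w(\mathbf s,\mathbf x):=\prod_{j=1}^d\sin(2^{s_j}x_j)$ and $W(\mathbf s):=\{\mathbf x: w(\mathbf s,\mathbf x)=0\}$. A set $X_m=\{\xi^i\}_{i=1}^m$ is an $(n,l)$-net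 if $|X_m\setminus W(\mathbf s)|\le 2^l$ for all $\mathbf s$ with $\|\mathbf s\|_1=n$. For $\mathbf s\in\mathbb N_0^d$ let $\rho(\mathbf s):=\{\mathbf k\in\mathbb Z^d:[2^{s_j-1}]\le|k_j|<2^{s_j},\ j=1,\dots,d\}$ ($[\cdot]$ is the integer part), $\delta_{\mathbf s}(f):=\sum_{\mathbf k\in\rho(\mathbf s)}\hat f(\mathbf k)e^{i(\mathbf k,\mathbf x)}$. For $1\le\theta<\infty$, $$\|f\|_{\mathbf B^r_{q,\theta}}:=\Big(\sum_{\mathbf s}\big(\|\delta_{\mathbf s}(f)\|_q2^{r\|\mathbf s\|_1}\big)^\theta\Big)^{1/\theta},\qquad \|f\|_{\mathbf B^r_{q,\infty}}:=\sup_{\mathbf s}\|\delta_{\mathbf s}(f)\|_q2^{r\|\mathbf s\|_1},$$ and $\mathbf B^r_{q,\theta}$ also denotes the unit ball $\{f:\|f\|_{\mathbf B^r_{q,\theta}}\le1\}$. $\gg$ means that the left side is at least $c$ times the right side, with $c>0$ independent of $n\in\mathbb N$, $m$, the net $X_m$ and the functions $\psi_j$ (it may depend on $r,p,q,\theta,d$). *)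

(* Defs.v *)
From HB Require Import structures.
From mathcomp Require Import all_boot all_order all_algebra.
From mathcomp Require Import complex.
From mathcomp Require Import all_classical all_reals all_analysis.

Set Implicit Arguments.
Unset Strict Implicit.
Unset Printing Implicit Defensive.

Import Order.TTheory GRing.Theory Num.Theory.
Import numFieldNormedType.Exports.

Local Open Scope classical_set_scope.
Local Open Scope ring_scope.

Section product_probability.
Context d1 d2 (T1 : measurableType d1) (T2 : measurableType d2) (R : realType).
Variables (P1 : probability T1 R) (P2 : probability T2 R).

Definition product_probability : set (T1 * T2) -> \bar R := (P1 \x P2)%E.

HB.instance Definition _ := Measure.on product_probability.

Let product_probability_setT : product_probability setT = 1%E.
Proof.
rewrite /product_probability -setXTT product_measure1E//.
by rewrite -[RHS]mule1 -{1}(@probability_setT _ _ _ P1) -(@probability_setT _ _ _ P2).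
Qed.

HB.instance Definition _ := Measure_isProbability.Build _ _ _
  product_probability product_probability_setT.

End product_probability.

(* Points of R^d; measurableTypeR R is R with its Borel sigma-algebra, and tuples
   carry the product sigma-algebra. *)
Notation rpoint R d := (d.-tuple (measurableTypeR R)).

Section torus_measure.
Context {R : realType}.

Lemma pi2_gt0 : (0 : R) < 2 * pi.
Proof. by rewrite mulr_gt0// pi_gt0. Qed.

Definition torus_cons d (z : measurableTypeR R * rpoint R d) : rpoint R d.+1 :=
  [tuple of z.1 :: z.2].

Let measurable_torus_cons d : measurable_fun setT (@torus_cons d).
Proof. exact: measurable_cons. Qed.

HB.instance Definition _ d :=
  isMeasurableFun.Build _ _ _ _ (@torus_cons d) (@measurable_torus_cons d).

(* The normalized Lebesgue measure (2pi)^-d dx of the torus, as a measure on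
   R^d carried by the fundamental cube: the d-fold product of the uniform
   probability on [0, 2pi]. The faces of the cube are null, so that [0, 2pi] and
   [0, 2pi[ make no difference here. *)
Fixpoint torus_measure (d : nat) : probability (rpoint R d) R :=
  if d is d'.+1 then
    distribution (product_probability (uniform_prob pi2_gt0) (torus_measure d'))
      (@torus_cons d')
  else dirac ([tuple] : rpoint R 0).

End torus_measure.

Section function_spaces.
Context {R : realType} {d : nat}.
Implicit Types (f g : rpoint R d -> R[i]) (x : rpoint R d).

Definition torus : set (rpoint R d) :=
  [set x | forall i, 0 <= (tnth x i : R) < 2 * pi].

Definition shift2pi (j : 'I_d) x : rpoint R d :=
  [tuple (tnth x i : R) + (if i == j then 2 * pi else 0) | i < d].

Definition periodic f := forall j x, f (shift2pi j x) = f x.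

(* The topology of R^d is the one of row vectors, R[i]^o is R[i] with the topology
   of its modulus. *)
Definition torus_continuous f :=
  continuous (fun v : 'rV[R]_d => f [tuple v ord0 i | i < d] : R[i]^o).

Definition Lpnorm (p : R) f : \bar R :=
  Lnorm (torus_measure d) p%:E (fun x => (Normc.normc (f x))%:E).

Definition in_Lp (p : R) f :=
  [/\ periodic f,
      measurable_fun setT (fun x => complex.Re (f x)),
      measurable_fun setT (fun x => complex.Im (f x)) &
      (Lpnorm p f < +oo)%E].

Definition torus_integral f : R[i] :=
  Complex (Rintegral (torus_measure d) setT (fun x => complex.Re (f x)))
          (Rintegral (torus_measure d) setT (fun x => complex.Im (f x))).

Definition expi (t : R) : R[i] := Complex (cos t) (sin t).

Definition dotp (k : d.-tuple int) x : R :=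
  \sum_(j < d) (tnth k j)%:~R * (tnth x j : R).

Definition fourier_coef f (k : d.-tuple int) : R[i] :=
  torus_integral (fun x => f x * expi (- dotp k x)).

Definition norm1 (s : d.-tuple nat) : nat := (\sum_(j < d) tnth s j)%N.

(* (2 ^ s) %/ 2 is the integer part of 2^(s-1), which is 0 for s = 0. *)
Definition rho (s : d.-tuple nat) : set (d.-tuple int) :=
  [set k | forall j, (2 ^ tnth s j %/ 2 <= `|tnth k j|%N < 2 ^ tnth s j)%N].

Definition delta (s : d.-tuple nat) f x : R[i] :=
  \sum_(k \in rho s) fourier_coef f k * expi (dotp k x).

(* Meant for 1 <= theta <= +oo. *)
Definition besov_norm (r q : R) (theta : \bar R) f : \bar R :=
  let a (s : d.-tuple nat) : \bar R :=
    (Lpnorm q (delta s f) * (2 `^ (r * (norm1 s)%:R))%:E)%E in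
  if theta is t%:E then ((\esum_(s in setT) (a s `^ t)) `^ t^-1)%E
  else ereal_sup (range a).

Definition besov_ball (r q : R) (theta : \bar R) : set (rpoint R d -> R[i]) :=
  [set f | in_Lp 1 f /\ (besov_norm r q theta f <= 1)%E].

End function_spaces.

Section recovery.
Context {R : realType} {d m : nat}.
Variable xi : 'I_m -> rpoint R d.

Definition recover (psi : 'I_m -> rpoint R d -> R[i]) (f : rpoint R d -> R[i])
    (x : rpoint R d) : R[i] :=
  \sum_(j < m) f (xi j) * psi j x.

Definition recovery_error (psi : 'I_m -> rpoint R d -> R[i])
    (W : set (rpoint R d -> R[i])) (p : R) : \bar R :=
  ereal_sup [set Lpnorm p (fun x => f x - recover psi f x)
            | f in W `&` torus_continuous].

Definition wfun (s : d.-tuple nat) (x : rpoint R d) : R :=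
  \prod_(j < d) sin (2 ^+ tnth s j * (tnth x j : R)).

Definition wzeros (s : d.-tuple nat) : set (rpoint R d) :=
  [set x | wfun s x = 0].

Definition is_net (n l : nat) :=
  forall s : d.-tuple nat, norm1 s = n ->
    (range xi `\` wzeros s #<= `I_(2 ^ l))%card.

End recovery.

(* Main.v *)
Require Import Defs.
From mathcomp Require Import all_boot all_order all_algebra.
From mathcomp Require Import complex.
From mathcomp Require Import all_classical all_reals all_analysis.
From mathcomp Require Import measurable_realfun.
From mathcomp Require Import ring lra zify.

(** A lower bound for the recovery error follows from a fooling function: a
    function [F] of the Besov ball which vanishes at all the points [xi j] is
    recovered by 0, so that the error is at least the norm of [F] in [L_p].

    Fix [s] with [norm1 s = n] and put [N j = 2 ^ s j]. The net has at most
    [2 ^ (n - 1)] points outside of [wzeros s], fewer than the [2 ^ n]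
    frequencies of the box [0 <= k j < N j]. Some nonzero polynomial [t] with
    frequencies in the box thus vanishes at these points ([annihilator]), and the
    product of [t] with [wpoly N], a polynomial vanishing on [wzeros s], vanishes
    at all the points of the net. It is not zero ([box_wpoly_neq0]). Divide it by
    the supremum of its modulus, choose a point [y] where the quotient has
    modulus at least 1/2, and multiply by the square of the normalized one-sided
    Dirichlet kernel centered at [y] and by a character. This gives [f_s]
    ([exists_bump]) which
    - has its spectrum in a single dyadic block [rho (shift4 s)], whence
      [delta] acts trivially on it, including for [q = 1];
    - is bounded by a product of Fejer kernels, with values between 0 and 1
      and integral [2 ^- n];
    - has a square integral of at least a constant times [2 ^- n], by Nikolskii's
      inequality at the point [y].

    Take [F] to be the sum of signed multiples of the [f_s], with [s] in a family
    of [B ^ (d - 1)] blocks of norm [n], where [B] is comparable to [n]. The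
    blocks being disjoint, the Besov norm is immediate ([besov_norm_le1]). For the
    lower bound in [L_p], averaging [|F| ^ p] over all signs gives at least half
    of the [p]-th power of the largest [|f_s|], at each point
    ([sum_signs_powR]). It remains to see that some [|f_s|] is at least [lam] on
    a set of measure comparable to the number of blocks times [2 ^- n]. This is a
    second moment argument ([signs_lower_bound]): two Fejer kernels, of blocks
    [s] and [s'], have a correlation of at most the inverse of the product of
    the [2 ^ max (s j) (s' j)], wherever they are centered ([mean_fejerM]), and
    the sum of these over [s'] is at most a constant times [2 ^- n]
    ([block_correlation]). *)

Set Implicit Arguments.
Unset Strict Implicit.
Unset Printing Implicit Defensive.

Import Order.TTheory GRing.Theory Num.Theory.
Import numFieldNormedType.Exports.
Local Open Scope classical_set_scope.
Local Open Scope ring_scope.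

(** * Bounded measurable functions on a probability space *)

Section bounded_measurable.
Context dT (T : measurableType dT) (R : realType).
Implicit Types f g : T -> R.

(** Bounded and measurable: such functions form an algebra, on which the
    mean is linear and monotone without any integrability condition. *)
Definition bmeas f :=
  measurable_fun setT f /\ exists M, forall x, `|f x| <= M.

Lemma bmeas_cst (c : R) : bmeas (fun=> c).
Proof. by split; [exact: measurable_cst|exists `|c|]. Qed.

Lemma bmeasD f g : bmeas f -> bmeas g -> bmeas (fun x => f x + g x).
Proof.
move=> [mf [M hM]] [mg [L hL]]; split; first exact: measurable_funD.
by exists (M + L) => x; rewrite (le_trans (ler_normD _ _))// lerD.
Qed.

Lemma bmeasN f : bmeas f -> bmeas (fun x => - f x).
Proof.
move=> [mf [M hM]]; split; last by exists M => x; rewrite normrN.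
exact: measurableT_comp.
Qed.

Lemma bmeasB f g : bmeas f -> bmeas g -> bmeas (fun x => f x - g x).
Proof. by move=> bf bg; exact: bmeasD bf (bmeasN bg). Qed.

Lemma bmeasM f g : bmeas f -> bmeas g -> bmeas (fun x => f x * g x).
Proof.
move=> [mf [M hM]] [mg [L hL]]; split; first exact: measurable_funM.
by exists (M * L) => x; rewrite normrM ler_pM.
Qed.

Lemma bmeas_sum (I : Type) (r : seq I) (P : pred I) (f : I -> T -> R) :
  (forall i, bmeas (f i)) -> bmeas (fun x => \sum_(i <- r | P i) f i x).
Proof.
move=> bf; elim: r => [|i r IH].
  by under eq_fun do rewrite big_nil; exact: bmeas_cst.
under eq_fun do rewrite big_cons.
by case: (P i) => //; exact: bmeasD.
Qed.

Lemma bmeas_powR (p : R) f : 0 <= p -> bmeas f -> (forall x, 0 <= f x) ->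
  bmeas (fun x => f x `^ p).
Proof.
move=> p0 [mf [M hM]] f0; split.
  by apply: (measurableT_comp (measurable_powR p)).
exists (M `^ p) => x; rewrite ger0_norm ?powR_ge0// ge0_ler_powR ?nnegrE//.
  by rewrite (le_trans _ (hM x)).
by rewrite (le_trans _ (hM x))// ler_norm.
Qed.

Variable P : probability T R.

Lemma bmeas_integrable f : bmeas f -> P.-integrable setT (EFin \o f).
Proof.
move=> [mf [M hM]]; apply: (@le_integrable _ _ _ _ _ measurableT _ (cst M%:E)).
- exact/measurable_EFinP.
- by move=> x _ /=; rewrite lee_fin (le_trans (hM x))// ler_norm.
- exact: finite_measure_integrable_cst.
Qed.

(** The expectation, as a real number. *)
Definition mean f : R := Rintegral P setT f.

Lemma mean_cst c : mean (fun=> c) = c.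
Proof. by rewrite /mean Rintegral_cst// [X in fine X]probability_setT mulr1. Qed.

Lemma meanD f g : bmeas f -> bmeas g ->
  mean (fun x => f x + g x) = mean f + mean g.
Proof. by move=> bf bg; rewrite /mean RintegralD//; exact: bmeas_integrable. Qed.

Lemma meanZ c f : bmeas f -> mean (fun x => c * f x) = c * mean f.
Proof. by move=> bf; rewrite /mean RintegralZl//; exact: bmeas_integrable. Qed.

Lemma meanB f g : bmeas f -> bmeas g ->
  mean (fun x => f x - g x) = mean f - mean g.
Proof. by move=> bf bg; rewrite /mean RintegralB//; exact: bmeas_integrable. Qed.

Lemma mean_sum (I : Type) (r : seq I) (Q : pred I) (f : I -> T -> R) :
  (forall i, bmeas (f i)) ->
  mean (fun x => \sum_(i <- r | Q i) f i x) = \sum_(i <- r | Q i) mean (f i).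
Proof.
move=> bf; elim: r => [|i r IH].
  by under eq_fun do rewrite big_nil; rewrite big_nil mean_cst.
under eq_fun do rewrite big_cons; rewrite big_cons.
case: (Q i) => //; rewrite meanD ?IH//; exact: bmeas_sum.
Qed.

Lemma le_mean f g : bmeas f -> bmeas g -> (forall x, f x <= g x) ->
  mean f <= mean g.
Proof.
by move=> bf bg fg; rewrite /mean le_Rintegral//; exact: bmeas_integrable.
Qed.

Lemma mean_ge0 f : (forall x, 0 <= f x) -> 0 <= mean f.
Proof. by move=> f0; rewrite /mean Rintegral_ge0. Qed.

Lemma meanE f : bmeas f -> (\int[P]_x (f x)%:E = (mean f)%:E)%E.
Proof.
move=> bf; rewrite /mean /Rintegral fineK//; apply: integrable_fin_num => //.
exact: bmeas_integrable.
Qed.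

Lemma Lnorm_mean (p : R) f : 0 < p -> bmeas f -> (forall x, 0 <= f x) ->
  Lnorm P p%:E (EFin \o f) = ((mean (fun x => f x `^ p)) `^ p^-1)%:E.
Proof.
move=> p0 bf f0; rewrite unlock /Lnorm -poweR_EFin -meanE; last first.
  by apply: bmeas_powR => //; exact: ltW.
by congr (_ `^ _)%E; apply: eq_integral => x _ /=; rewrite ger0_norm.
Qed.

End bounded_measurable.

Lemma bmeas_comp d1 d2 (T1 : measurableType d1) (T2 : measurableType d2)
    (R : realType) (f : T2 -> R) (h : T1 -> T2) :
  measurable_fun setT h -> bmeas f -> bmeas (f \o h).
Proof.
move=> mh [mf [M hM]]; split; first exact: measurableT_comp.
by exists M => x; exact: hM.
Qed.

Section mean_product.
Context d1 d2 (T1 : measurableType d1) (T2 : measurableType d2) (R : realType).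
Variables (P1 : probability T1 R) (P2 : probability T2 R).

Lemma mean_prod (f : T1 -> R) (g : T2 -> R) : bmeas f -> bmeas g ->
  mean (product_probability P1 P2) (fun z => f z.1 * g z.2)
  = mean P1 f * mean P2 g.
Proof.
move=> bf bg.
have bF : bmeas (fun z : T1 * T2 => f z.1 * g z.2).
  by apply: bmeasM; [exact: (bmeas_comp measurable_fst bf)
                    |exact: (bmeas_comp measurable_snd bg)].
have bfc x : bmeas (fun y => f x * g y) by apply: bmeasM => //; exact: bmeas_cst.
rewrite [LHS]/mean /Rintegral.
have -> : (\int[product_probability P1 P2]_x (f x.1 * g x.2)%:E
           = \int[P1]_x (f x * mean P2 g)%:E)%E.
  rewrite -(@integral12_prod_meas1 _ _ _ _ _ P1 P2
     (fun z => (f z.1 * g z.2)%:E))//.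
    apply: eq_integral => x _; rewrite -(meanZ P2)//.
    exact: (meanE P2 (bfc x)).
  exact: (bmeas_integrable (product_probability P1 P2) bF).
rewrite (meanE P1 (f := fun x => f x * mean P2 g)) /=; last first.
  by apply: bmeasM => //; exact: bmeas_cst.
by under eq_fun do rewrite mulrC; rewrite meanZ// mulrC.
Qed.

End mean_product.

(** * Complex-valued functions *)

Section complex_modulus.
Context {R : realType}.
Implicit Types z w : R[i].
Local Notation normc := (@Normc.normc R).

Lemma ReD z w : complex.Re (z + w) = complex.Re z + complex.Re w.
Proof. by case: z; case: w. Qed.

Lemma ImD z w : complex.Im (z + w) = complex.Im z + complex.Im w.
Proof. by case: z; case: w. Qed.

Lemma ReM z w : complex.Re (z * w) = complex.Re z * complex.Re w - complex.Im z * complex.Im w.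
Proof. by case: z; case: w. Qed.

Lemma ImM z w : complex.Im (z * w) = complex.Re z * complex.Im w + complex.Im z * complex.Re w.
Proof. by case: z; case: w. Qed.

Lemma complex_ext z w : complex.Re z = complex.Re w -> complex.Im z = complex.Im w -> z = w.
Proof. by case: z => a b; case: w => c d /= -> ->. Qed.

Lemma normc_ge0 z : 0 <= normc z.
Proof. by case: z => a b; rewrite sqrtr_ge0. Qed.

Lemma sqr_normcE z : normc z ^+ 2 = complex.Re z ^+ 2 + complex.Im z ^+ 2.
Proof. by case: z => a b /=; rewrite sqr_sqrtr// addr_ge0// sqr_ge0. Qed.

Lemma normc_sum (I : Type) (r : seq I) (P : pred I) (F : I -> R[i]) :
  normc (\sum_(i <- r | P i) F i) <= \sum_(i <- r | P i) normc (F i).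
Proof.
elim/big_ind2: _ => [|z a w b za wb|//]; first by rewrite Normc.normc0.
by rewrite (le_trans (le_normcD _ _))// lerD.
Qed.

Lemma normc_prod (I : Type) (r : seq I) (P : pred I) (F : I -> R[i]) :
  normc (\prod_(i <- r | P i) F i) = \prod_(i <- r | P i) normc (F i).
Proof.
by elim/big_rec2: _ => [|i z w _ <-]; [rewrite Normc.normc1|rewrite Normc.normcM].
Qed.

Lemma normc_real (a : R) : normc a%:C%C = `|a|.
Proof. by rewrite /= expr0n/= addr0 sqrtr_sqr. Qed.

Lemma normc_neq0 z : (0 < normc z) = (z != 0).
Proof.
apply/idP/idP => [|z0]; first by apply: contraTneq => ->; rewrite Normc.normc0 ltxx.
rewrite lt_def normc_ge0 andbT; apply: contra z0 => /eqP.
by move/Normc.eq0_normc => ->.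
Qed.

Lemma expiD (a b : R) : expi (a + b) = expi a * expi b.
Proof.
by apply: complex_ext; rewrite ?ReM ?ImM /= ?cosD ?sinD// addrC mulrC [X in _ + X]mulrC addrC.
Qed.

Lemma expi0 : expi (0 : R) = 1.
Proof. by rewrite /expi cos0 sin0. Qed.

Lemma expi_sum (I : Type) (r : seq I) (P : pred I) (F : I -> R) :
  expi (\sum_(i <- r | P i) F i) = \prod_(i <- r | P i) expi (F i).
Proof. by elim/big_rec2: _ => [|i y x _ <-]; [exact: expi0|rewrite expiD]. Qed.

Lemma normc_expi (a : R) : normc (expi a) = 1.
Proof. by rewrite /= cos2Dsin2 sqrtr1. Qed.

Lemma expiN (a : R) : expi (- a) = (expi a)^*%C.
Proof. by rewrite /expi cosN sinN. Qed.

Lemma expi_nat2pi (n : nat) : expi (n%:R * (2 * pi) : R) = 1.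
Proof.
elim: n => [|n IH]; first by rewrite mul0r expi0.
rewrite -natr1 mulrDl mul1r expiD IH mul1r mulrC mulr_natr.
by rewrite /expi cos2pi sin2pi.
Qed.

Lemma expi_int2pi (k : int) : expi (k%:~R * (2 * pi) : R) = 1.
Proof.
case: k => n; first exact: expi_nat2pi.
by rewrite NegzE mulrNz mulNr expiN expi_nat2pi conjc1.
Qed.

End complex_modulus.
Arguments normc_ge0 {R}.

Section complex_bounded_measurable.
Context dT (T : measurableType dT) (R : realType).
Implicit Types f g : T -> R[i].

(** Bounded measurable complex-valued functions, coordinatewise. *)
Definition cbmeas f := bmeas (fun x => complex.Re (f x)) /\ bmeas (fun x => complex.Im (f x)).

Lemma cbmeas_cst (c : R[i]) : cbmeas (fun=> c).
Proof. by split; exact: bmeas_cst. Qed.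

Lemma cbmeasD f g : cbmeas f -> cbmeas g -> cbmeas (fun x => f x + g x).
Proof.
move=> [rf jf] [rg jg]; split.
  by under eq_fun do rewrite ReD; exact: bmeasD.
by under eq_fun do rewrite ImD; exact: bmeasD.
Qed.

Lemma cbmeasM f g : cbmeas f -> cbmeas g -> cbmeas (fun x => f x * g x).
Proof.
move=> [rf jf] [rg jg]; split.
  by under eq_fun do rewrite ReM; apply: bmeasB; exact: bmeasM.
by under eq_fun do rewrite ImM; apply: bmeasD; exact: bmeasM.
Qed.

Lemma cbmeas_conj f : cbmeas f -> cbmeas (fun x => (f x)^*%C).
Proof.
have ReJ (z : R[i]) : complex.Re z^*%C = complex.Re z by case: z.
have ImJ (z : R[i]) : complex.Im z^*%C = - complex.Im z by case: z.
move=> [rf jf]; split; first by under eq_fun do rewrite ReJ.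
by under eq_fun do rewrite ImJ; exact: bmeasN.
Qed.

Lemma cbmeas_sum (I : Type) (r : seq I) (Q : pred I) (f : I -> T -> R[i]) :
  (forall i, cbmeas (f i)) -> cbmeas (fun x => \sum_(i <- r | Q i) f i x).
Proof.
move=> bf; elim: r => [|i r IH].
  by under eq_fun do rewrite big_nil; exact: cbmeas_cst.
under eq_fun do rewrite big_cons.
by case: (Q i) => //; exact: cbmeasD.
Qed.

Lemma cbmeas_prod (I : Type) (r : seq I) (Q : pred I) (f : I -> T -> R[i]) :
  (forall i, cbmeas (f i)) -> cbmeas (fun x => \prod_(i <- r | Q i) f i x).
Proof.
move=> bf; elim: r => [|i r IH].
  by under eq_fun do rewrite big_nil; exact: cbmeas_cst.
under eq_fun do rewrite big_cons.
by case: (Q i) => //; exact: cbmeasM.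
Qed.

Lemma bmeas_sqr_normc f : cbmeas f -> bmeas (fun x => Normc.normc (f x) ^+ 2).
Proof.
move=> [rf jf]; under eq_fun do rewrite sqr_normcE !expr2.
by apply: bmeasD; exact: bmeasM.
Qed.

Lemma bmeas_normc f : cbmeas f -> bmeas (fun x => Normc.normc (f x)).
Proof.
move=> bf; have -> : (fun x => Normc.normc (f x)) =
    (fun x => (Normc.normc (f x) ^+ 2) `^ 2^-1).
  by apply/funext => x; rewrite powR12_sqrt ?sqr_ge0// sqrtr_sqr ger0_norm// normc_ge0.
by apply: bmeas_powR => //; [exact: bmeas_sqr_normc|move=> x; exact: sqr_ge0].
Qed.

Variable P : probability T R.

(** The complex expectation; on the torus this is [torus_integral]. *)
Definition cmean f : R[i] :=
  Complex (mean P (fun x => complex.Re (f x))) (mean P (fun x => complex.Im (f x))).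

Lemma cmean_cst c : cmean (fun=> c) = c.
Proof. by apply: complex_ext; rewrite /= mean_cst. Qed.

Lemma cmeanD f g : cbmeas f -> cbmeas g ->
  cmean (fun x => f x + g x) = cmean f + cmean g.
Proof.
move=> [rf jf] [rg jg]; apply: complex_ext; rewrite ?ReD ?ImD /= -meanD//.
  by congr mean; apply/funext => x; rewrite ReD.
by congr mean; apply/funext => x; rewrite ImD.
Qed.

Lemma cmeanZ c f : cbmeas f -> cmean (fun x => c * f x) = c * cmean f.
Proof.
have bZ a h : bmeas h -> bmeas (fun x : T => (a : R) * h x).
  by move=> bh; apply: bmeasM => //; exact: bmeas_cst.
move=> [rf jf]; apply: complex_ext; rewrite ?ReM ?ImM /= -!meanZ//.
  rewrite -meanB; try exact: bZ.
  by congr mean; apply/funext => x; rewrite ReM.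
rewrite -meanD; try exact: bZ.
by congr mean; apply/funext => x; rewrite ImM.
Qed.

Lemma cmean_sum (I : Type) (r : seq I) (Q : pred I) (f : I -> T -> R[i]) :
  (forall i, cbmeas (f i)) ->
  cmean (fun x => \sum_(i <- r | Q i) f i x) = \sum_(i <- r | Q i) cmean (f i).
Proof.
move=> bf; elim: r => [|i r IH].
  by under eq_fun do rewrite big_nil; rewrite big_nil cmean_cst.
under eq_fun do rewrite big_cons; rewrite big_cons.
case: (Q i) => //; rewrite cmeanD ?IH//; exact: cbmeas_sum.
Qed.

Lemma cmean_sqr_normc f : cbmeas f ->
  cmean (fun x => f x * (f x)^*%C) = (mean P (fun x => Normc.normc (f x) ^+ 2))%:C%C.
Proof.
move=> bf; have E z : z * z^*%C = (Normc.normc z ^+ 2)%:C%C :> R[i].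
  apply: complex_ext; rewrite /= ?sqr_normcE ?ReM ?ImM; case: z => a b /=; ring.
by under eq_fun do rewrite E; apply: complex_ext; rewrite /= ?mean_cst.
Qed.

End complex_bounded_measurable.

Lemma cbmeas_comp d1 d2 (T1 : measurableType d1) (T2 : measurableType d2)
    (R : realType) (f : T2 -> R[i]) (h : T1 -> T2) :
  measurable_fun setT h -> cbmeas f -> cbmeas (f \o h).
Proof.
move=> mh [rf jf].
by split; [exact: (bmeas_comp mh rf)|exact: (bmeas_comp mh jf)].
Qed.

Lemma cmean_prod d1 d2 (T1 : measurableType d1) (T2 : measurableType d2)
    (R : realType) (P1 : probability T1 R) (P2 : probability T2 R)
    (f : T1 -> R[i]) (g : T2 -> R[i]) : cbmeas f -> cbmeas g ->
  cmean (product_probability P1 P2) (fun z => f z.1 * g z.2)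
  = cmean P1 f * cmean P2 g.
Proof.
move=> [rf jf] [rg jg].
have bfst h : bmeas h -> bmeas (fun z : T1 * T2 => (h z.1 : R)).
  by move=> bh; exact: (bmeas_comp measurable_fst bh).
have bsnd h : bmeas h -> bmeas (fun z : T1 * T2 => (h z.2 : R)).
  by move=> bh; exact: (bmeas_comp measurable_snd bh).
have bM h k : bmeas h -> bmeas k -> bmeas (fun z : T1 * T2 => h z.1 * k z.2 : R).
  by move=> bh bk; apply: bmeasM; [exact: bfst|exact: bsnd].
apply: complex_ext; rewrite ?ReM ?ImM /= -!mean_prod//.
  rewrite -(meanB _ (bM _ _ rf rg) (bM _ _ jf jg)).
  by congr mean; apply/funext => x; rewrite ReM.
rewrite -(meanD _ (bM _ _ rf jg) (bM _ _ jf rg)).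
by congr mean; apply/funext => x; rewrite ImM.
Qed.

(** * Orthogonality of the characters of the torus *)

Section characters.
Context {R : realType}.

Local Notation circle := (uniform_prob (@pi2_gt0 R)).

Lemma bmeas_cos (c : R) : bmeas (fun t : measurableTypeR R => cos (c * t)).
Proof.
split; last by exists 1 => x; exact: cos_max.
apply: continuous_measurable_fun => x; apply: continuous_comp.
  by apply: continuousM => //; exact: cvg_cst.
exact: continuous_cos.
Qed.

Lemma bmeas_sin (c : R) : bmeas (fun t : measurableTypeR R => sin (c * t)).
Proof.
split; last by exists 1 => x; exact: sin_max.
apply: continuous_measurable_fun => x; apply: continuous_comp.
  by apply: continuousM => //; exact: cvg_cst.
exact: continuous_sin.
Qed.

Lemma cbmeas_expi (c : R) : cbmeas (fun t : measurableTypeR R => expi (c * t)).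
Proof. by split; [exact: bmeas_cos|exact: bmeas_sin]. Qed.

(** Sign conditions are needed by the formula for the uniform law, whence the
    constant 1 added to the cosine and the sine below. *)
Lemma mean_circle_FTC (F f : R -> R) : bmeas (f : measurableTypeR R -> R) ->
  continuous f -> (forall x, 0 <= f x) -> (forall x : R, is_derive x 1 F (f x)) ->
  mean circle f = (2 * pi)^-1 * (F (2 * pi) - F 0).
Proof.
move=> bf cf f0 dF.
rewrite /mean /Rintegral integral_uniform//; last first.
  by apply/measurable_EFinP; case: bf.
rewrite (@continuous_FTC2 _ f F)//; last 4 first.
- exact: pi2_gt0.
- by apply: continuous_subspaceT => x; exact: cf.
- have cF x : {for x, continuous F}.
    by apply/differentiable_continuous/derivable1_diffP; case: (dF x).
  split=> [x _||]; first by case: (dF x).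
    by apply: cvg_at_right_filter; exact: cF.
  by apply: cvg_at_left_filter; exact: cF.
- by move=> x _; rewrite derive1E; apply: derive_val.
by rewrite subr0.
Qed.

Lemma mean_circle_cos (k : int) : k != 0 ->
  mean circle (fun t => cos (k%:~R * t)) = 0.
Proof.
move=> k0; have k0' : k%:~R != 0 :> R by rewrite intr_eq0.
have b1 := bmeas_cst (measurableTypeR R) (1 : R).
have bc := bmeas_cos k%:~R.
have : mean circle (fun t => 1 + cos (k%:~R * t)) = 1; last first.
  by rewrite meanD// mean_cst => h; rewrite -[LHS](addKr 1) h addNr.
pose F (t : R) := t + k%:~R^-1 * sin (k%:~R * t).
have dF (x : R) : is_derive x 1 F (1 + cos (k%:~R * x)).
  apply: is_derive_eq.
  by rewrite /GRing.scale /= !mulr1 mulrC mulfK.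
rewrite (mean_circle_FTC (bmeasD b1 bc) _ _ dF) /F.
- have := @expi_int2pi R k; rewrite /expi => -[_ ->].
  by rewrite !mulr0 sin0 mulr0 !addr0 subr0 mulVf// gt_eqF// pi2_gt0.
- move=> x; apply: continuousD; first exact: cvg_cst.
  apply: continuous_comp; last exact: continuous_cos.
  by apply: continuousM => //; exact: cvg_cst.
- by move=> x; have := cos_geN1 (k%:~R * x : R); lra.
Qed.

Lemma mean_circle_sin (k : int) : k != 0 ->
  mean circle (fun t => sin (k%:~R * t)) = 0.
Proof.
move=> k0; have k0' : k%:~R != 0 :> R by rewrite intr_eq0.
have b1 := bmeas_cst (measurableTypeR R) (1 : R).
have bc := bmeas_sin k%:~R.
have : mean circle (fun t => 1 + sin (k%:~R * t)) = 1; last first.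
  by rewrite meanD// mean_cst => h; rewrite -[LHS](addKr 1) h addNr.
pose F (t : R) := t - k%:~R^-1 * cos (k%:~R * t).
have dF (x : R) : is_derive x 1 F (1 + sin (k%:~R * x)).
  apply: is_derive_eq.
  rewrite /GRing.scale /= !mulr1.
  by rewrite mulrC mulfK// opprK.
rewrite (mean_circle_FTC (bmeasD b1 bc) _ _ dF) /F.
- have := @expi_int2pi R k; rewrite /expi => -[-> _].
  rewrite !mulr0 cos0 sub0r opprK mulr1 subrK.
  by rewrite mulVf// gt_eqF// pi2_gt0.
- move=> x; apply: continuousD; first exact: cvg_cst.
  apply: continuous_comp; last exact: continuous_sin.
  by apply: continuousM => //; exact: cvg_cst.
- by move=> x; have := sin_geN1 (k%:~R * x : R); lra.
Qed.

Lemma cmean_circle_expi (k : int) :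
  cmean circle (fun t => expi (k%:~R * t)) = (k == 0)%:R.
Proof.
case: eqVneq => [->|k0].
  by under [X in cmean _ X]eq_fun do rewrite mul0r expi0; rewrite cmean_cst.
by apply: complex_ext; rewrite /= ?mean_circle_cos ?mean_circle_sin.
Qed.

(** Fubini for tensor products, by induction along the recursive definition of
    the measure of the torus. *)
Lemma cmean_torus_prod d (g : 'I_d -> measurableTypeR R -> R[i]) :
  (forall j, cbmeas (g j)) ->
  cmean (torus_measure d) (fun x => \prod_(j < d) g j (tnth x j))
  = \prod_(j < d) cmean circle (g j).
Proof.
elim: d g => [|d IH] g bg.
  by rewrite big_ord0; under [X in cmean _ X]eq_fun do rewrite big_ord0; rewrite cmean_cst.
rewrite big_ord_recl -IH//.
have bG : cbmeas (fun x : rpoint R d => \prod_(j < d) g (lift ord0 j) (tnth x j)).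
  apply: cbmeas_prod => j; apply: (cbmeas_comp (f := g (lift ord0 j)) (h := fun x : rpoint R d => tnth x j)) => //.
  exact: measurable_tnth.
rewrite -(cmean_prod _ _ (bg ord0) bG).
have mean_dist (f : rpoint R d.+1 -> R) : bmeas f ->
  mean (torus_measure d.+1) f
  = mean (product_probability circle (torus_measure d)) (f \o @torus_cons R d).
  move=> [mf [M hM]]; rewrite /mean /Rintegral /= integral_distribution//.
    exact/measurable_EFinP.
  apply: (bmeas_integrable (product_probability circle (torus_measure d))
    (f := f \o @torus_cons R d)).
  apply: bmeas_comp => //; last by split=> //; exists M.
have bF : cbmeas (fun x : rpoint R d.+1 => \prod_(j < d.+1) g j (tnth x j)).
  apply: cbmeas_prod => j; apply: (cbmeas_comp (f := g j) (h := fun x : rpoint R d.+1 => tnth x j)) => //.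
  exact: measurable_tnth.
case: (bF) => bR bI.
rewrite {1}/cmean !mean_dist//.
rewrite /cmean; congr Complex; congr mean; apply/funext => -[t x] /=;
  rewrite big_ord_recl; congr (_ (_ * _)); apply: eq_bigr => j _;
  by rewrite !(tnth_nth 0).
Qed.

End characters.

(** * Trigonometric polynomials *)

(** Grouping the terms of a sum according to a key. *)
Lemma sum_regroup (V : nmodType) (K I : eqType) (r : seq K) (l : seq I)
    (key : I -> K) (Q : pred K) (G : I -> V) :
  uniq r -> {in l, forall a, key a \in r} ->
  \sum_(k <- r | Q k) \sum_(a <- l | key a == k) G a
  = \sum_(a <- l | Q (key a)) G a.
Proof.
move=> ur hr; rewrite (exchange_big_dep (fun a => Q (key a)))/=; last first.
  by move=> k a Qk /eqP ->.
rewrite big_seq_cond [RHS]big_seq_cond; apply: eq_bigr => a /andP[al Qa].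
rewrite -big_filter (_ : [seq k <- r | _] = [:: key a]) ?big_seq1//.
rewrite -[RHS](filter_pred1_uniq ur (hr _ al)); apply: eq_filter => k /=.
by rewrite eq_sym; case: eqP => [->|_]; rewrite ?Qa ?andbT ?andbF.
Qed.

Section trigonometric_polynomials.
Context {R : realType} {d : nat}.
Implicit Types (k l : d.-tuple int) (f g : rpoint R d -> R[i]).
Implicit Types (P Q : d.-tuple int -> Prop).

Local Notation mu := (@torus_measure R d).

(** The character of frequency [k], and the addition of frequencies. *)
Definition chr k (x : rpoint R d) : R[i] := expi (dotp k x).

Definition addk k l : d.-tuple int := [tuple tnth k j + tnth l j | j < d].

Lemma chrD k l x : chr (addk k l) x = chr k x * chr l x.
Proof.
rewrite /chr -expiD /dotp -big_split; congr expi; apply: eq_bigr => j _.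
by rewrite tnth_mktuple intrD mulrDl.
Qed.

Lemma normc_chr k x : Normc.normc (chr k x) = 1.
Proof. exact: normc_expi. Qed.

Lemma cbmeas_chr k : cbmeas (chr k).
Proof.
rewrite /chr; under eq_fun do rewrite /dotp expi_sum.
apply: cbmeas_prod => j.
exact: (cbmeas_comp (measurable_tnth j) (cbmeas_expi (tnth k j)%:~R)).
Qed.

Lemma chr_orth k l :
  cmean mu (fun x => chr k x * (chr l x)^*%C) = (k == l)%:R.
Proof.
have E (x : rpoint R d) : chr k x * (chr l x)^*%C
    = \prod_(j < d) expi ((tnth k j - tnth l j)%:~R * tnth x j).
  rewrite -expiN -expiD /dotp -sumrN -big_split -expi_sum /=.
  by congr expi; apply: eq_bigr => j _; rewrite intrB mulrBl.
under eq_fun do rewrite E.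
rewrite (cmean_torus_prod (fun j => cbmeas_expi (tnth k j - tnth l j)%:~R)).
under eq_bigr do rewrite cmean_circle_expi subr_eq0.
case: eqVneq => [->|kl]; first by rewrite big1// => j _; rewrite eqxx.
have [j hj] : exists j, tnth k j != tnth l j.
  apply/existsP; rewrite -negb_forall; apply: contra kl => /forallP h.
  by apply/eqP/eq_from_tnth => j; apply/eqP.
by rewrite (bigD1 j)//= (negbTE hj) mul0r.
Qed.

(** The polynomial with the list [s] of frequencies and coefficients, where a
    frequency may occur several times. *)
Definition tpoly (s : seq (d.-tuple int * R[i])) (x : rpoint R d) : R[i] :=
  \sum_(a <- s) a.2 * chr a.1 x.

(** [f] is a trigonometric polynomial all of whose frequencies satisfy [P]. *)
Definition trigp P f :=
  exists2 s, (forall a, a \in s -> P a.1) & forall x, f x = tpoly s x.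

Lemma cbmeas_tpoly s : cbmeas (tpoly s).
Proof.
by apply: cbmeas_sum => a; apply: cbmeasM; [exact: cbmeas_cst|exact: cbmeas_chr].
Qed.

Lemma trigp_cbmeas P f : trigp P f -> cbmeas f.
Proof. by move=> [s _ /funext ->]; exact: cbmeas_tpoly. Qed.

Lemma trigp_sub P Q f : (forall k, P k -> Q k) -> trigp P f -> trigp Q f.
Proof. by move=> PQ [s Ps fs]; exists s => // a /Ps /PQ. Qed.

Lemma eq_trigp P f g : (forall x, f x = g x) -> trigp P f -> trigp P g.
Proof. by move=> /funext ->. Qed.

Lemma trigp0 P : trigp P (fun=> 0).
Proof. by exists [::] => // x; rewrite /tpoly big_nil. Qed.

Lemma trigp_chr P k c : P k -> trigp P (fun x => c * chr k x).
Proof.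
move=> Pk; exists [:: (k, c)]; first by move=> a; rewrite inE => /eqP ->.
by move=> x; rewrite /tpoly big_seq1.
Qed.

Lemma trigpD P f g : trigp P f -> trigp P g -> trigp P (fun x => f x + g x).
Proof.
move=> [s Ps fs] [t Pt gt]; exists (s ++ t).
  by move=> a; rewrite mem_cat => /orP[/Ps|/Pt].
by move=> x; rewrite /tpoly big_cat fs gt.
Qed.

Lemma trigpM P Q S f g : (forall k l, P k -> Q l -> S (addk k l)) ->
  trigp P f -> trigp Q g -> trigp S (fun x => f x * g x).
Proof.
move=> PQS [s Ps fs] [t Qt gt].
exists [seq (addk a.1 b.1, a.2 * b.2) | a <- s, b <- t].
  by move=> _ /allpairsP[[a b] /= [/Ps Pa /Qt Qb ->]]; exact: PQS.
move=> x; rewrite fs gt /tpoly big_distrlr big_allpairs_dep /=.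
by apply: eq_bigr => a _; apply: eq_bigr => b _; rewrite chrD mulrACA.
Qed.

Lemma trigp_sum (I : Type) (r : seq I) (B : pred I) P (f : I -> rpoint R d -> R[i]) :
  (forall i, B i -> trigp P (f i)) -> trigp P (fun x => \sum_(i <- r | B i) f i x).
Proof.
move=> bf; elim: r => [|i r IH].
  by under eq_fun do rewrite big_nil; exact: trigp0.
under eq_fun do rewrite big_cons.
by case: (boolP (B i)) => // Bi; apply: trigpD => //; exact: bf.
Qed.

Lemma fourier_coef_tpoly s k :
  fourier_coef (tpoly s) k = \sum_(a <- s | a.1 == k) a.2.
Proof.
transitivity (cmean mu (fun x => \sum_(a <- s) (a.2 * (chr a.1 x * (chr k x)^*%C)))).
  rewrite /fourier_coef; congr torus_integral; apply/funext => x.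
  by rewrite /tpoly big_distrl/=; apply: eq_bigr => a _; rewrite expiN mulrA.
have bc l : cbmeas (fun x => chr l x * (chr k x)^*%C).
  by apply: cbmeasM; [|apply: cbmeas_conj]; exact: cbmeas_chr.
rewrite cmean_sum; last by move=> a; apply: cbmeasM; [exact: cbmeas_cst|exact: bc].
rewrite [RHS]big_mkcond; apply: eq_bigr => a _.
by rewrite cmeanZ// chr_orth; case: eqP; rewrite ?mulr1 ?mulr0.
Qed.

Lemma delta_tpoly (sc : d.-tuple nat) s x :
  delta sc (tpoly s) x = \sum_(a <- s | a.1 \in rho sc) a.2 * chr a.1 x.
Proof.
pose r := undup [seq a.1 | a <- s].
have fr k : k \notin r -> fourier_coef (tpoly s) k = 0.
  rewrite mem_undup fourier_coef_tpoly => kr; rewrite big_seq_cond big1// => a.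
  by case/andP => ais /eqP ak; move: kr; rewrite -ak map_f.
transitivity (\sum_(k <- r | k \in rho sc) fourier_coef (tpoly s) k * chr k x).
  rewrite bigfs ?undup_uniq//; last by move=> k _ /fr ->; rewrite mul0r.
  by apply: eq_fsbigl; apply/seteqP; split=> k /=; rewrite ?inE.
rewrite -(sum_regroup (r := r) (key := fst)) ?undup_uniq//; last first.
  by move=> a ais; rewrite mem_undup map_f.
apply: eq_bigr => k _; rewrite fourier_coef_tpoly big_distrl/=.
by apply: eq_bigr => a /eqP ->.
Qed.

(** Coefficients being sums over lists, linearity of [delta] is the
    concatenation of lists. *)
Lemma deltaD P Q (sc : d.-tuple nat) f g x : trigp P f -> trigp Q g ->
  delta sc (fun x => f x + g x) x = delta sc f x + delta sc g x.
Proof.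
move=> [s _ /funext ->] [t _ /funext ->].
have -> : (fun x => tpoly s x + tpoly t x) = tpoly (s ++ t).
  by apply/funext => y; rewrite /tpoly big_cat.
by rewrite !delta_tpoly big_cat.
Qed.

Lemma delta_sum (I : Type) (r : seq I) P (sc : d.-tuple nat)
    (f : I -> rpoint R d -> R[i]) x : (forall i, trigp P (f i)) ->
  delta sc (fun x => \sum_(i <- r) f i x) x = \sum_(i <- r) delta sc (f i) x.
Proof.
move=> tf; elim: r => [|i r IH].
  have -> : (fun x => \sum_(i <- [::]) f i x) = tpoly [::].
    by apply/funext => y; rewrite /tpoly !big_nil.
  by rewrite delta_tpoly !big_nil.
under eq_fun do rewrite big_cons.
by rewrite (deltaD (P := P) (Q := P))// ?IH ?big_cons//; exact: trigp_sum.
Qed.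

(** The dyadic blocks are pairwise disjoint. *)
Lemma rho_inj (s t : d.-tuple nat) k : rho s k -> rho t k -> s = t.
Proof.
have H a b m : (2 ^ a %/ 2 <= m < 2 ^ a)%N -> (2 ^ b %/ 2 <= m < 2 ^ b)%N -> (a <= b)%N.
  move=> /andP[am _] /andP[_ mb]; rewrite leqNgt; apply/negP => ba.
  have : (2 ^ b <= 2 ^ a %/ 2)%N.
    by case: a ba am => // a ba _; rewrite expnS mulKn// leq_exp2l.
  by move=> /leq_trans /(_ am); rewrite leqNgt mb.
move=> ks kt; apply: eq_from_tnth => j; apply/eqP; rewrite eqn_leq.
by apply/andP; split; [exact: H (ks j) (kt j)|exact: H (kt j) (ks j)].
Qed.

(** On a polynomial with spectrum in a block, [delta] is all or nothing. *)
Lemma delta_block (s t : d.-tuple nat) f x : trigp (rho t) f ->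
  delta s f x = if t == s then f x else 0.
Proof.
move=> [l lt /funext ->]; rewrite delta_tpoly; case: eqVneq => [<-|ts].
  by rewrite big_seq_cond /tpoly [RHS]big_seq; apply: eq_bigl => a;
    case: (boolP (a \in l)) => //= /lt ta; rewrite mem_set.
rewrite big_seq_cond big1// => a /andP[/lt ta /set_mem sa].
by rewrite (rho_inj ta sa) eqxx in ts.
Qed.

Lemma sqr_sum_le (I : Type) (r : seq I) (u : I -> R) :
  (\sum_(i <- r) u i) ^+ 2 <= (size r)%:R * \sum_(i <- r) u i ^+ 2.
Proof.
have cst w : \sum_(i <- r) \sum_(j <- r) w i = (size r)%:R * \sum_(i <- r) w i :> R.
  rewrite mulr_sumr; apply: eq_bigr => i _.
  by rewrite big_const_seq count_predT iter_addr_0 mulr_natl.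
have -> : (size r)%:R * (\sum_(i <- r) u i ^+ 2)
  = \sum_(i <- r) \sum_(j <- r) (u i ^+ 2 / 2 + u j ^+ 2 / 2).
  under [RHS]eq_bigr do rewrite big_split/=.
  rewrite big_split/= [X in _ + X]exchange_big/= !cst -mulrDr -big_split/=.
  by congr (_ * _); apply: eq_bigr => i _; lra.
rewrite expr2 big_distrlr/=; apply: ler_sum => i _; apply: ler_sum => j _.
by have := sqr_ge0 (u i - u j); nra.
Qed.

(** Parseval's identity. *)
Lemma parseval (r : seq (d.-tuple int)) (c : d.-tuple int -> R[i]) : uniq r ->
  mean mu (fun x => Normc.normc (\sum_(k <- r) c k * chr k x) ^+ 2)
  = \sum_(k <- r) Normc.normc (c k) ^+ 2.
Proof.
move=> ur; apply: (@complexI R).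
have bt : cbmeas (fun x => \sum_(k <- r) c k * chr k x).
  by apply: cbmeas_sum => k; apply: cbmeasM; [exact: cbmeas_cst|exact: cbmeas_chr].
rewrite -(cmean_sqr_normc mu bt) rmorph_sum/=.
transitivity (cmean mu (fun x => \sum_(k <- r) \sum_(l <- r)
    (c k * (c l)^*%C) * (chr k x * (chr l x)^*%C))).
  congr cmean; apply/funext => x; rewrite rmorph_sum big_distrlr/=.
  apply: eq_bigr => k _; apply: eq_bigr => l _.
  by rewrite rmorphM mulrACA.
have bc k l : cbmeas (fun x => chr k x * (chr l x)^*%C).
  by apply: cbmeasM; [|apply: cbmeas_conj]; exact: cbmeas_chr.
have bcc k l : cbmeas (fun x => (c k * (c l)^*%C) * (chr k x * (chr l x)^*%C)).
  by apply: cbmeasM => //; exact: cbmeas_cst.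
rewrite cmean_sum; last by move=> k; exact: cbmeas_sum.
apply: eq_big_seq => k kr.
rewrite cmean_sum// (bigD1_seq k)//= big1 ?addr0 => [|l /negbTE lk].
  by rewrite (cmeanZ _ _ (bc k k)) chr_orth eqxx mulr1 -sqr_normc normc_def rmorphXn /=;
    case: (c k).
by rewrite (cmeanZ _ _ (bc k l)) chr_orth eq_sym lk mulr0.
Qed.

End trigonometric_polynomials.

(** * Boxes of frequencies *)

Section boxes.
Context {R : realType} {d : nat}.
Implicit Types (N M : 'I_d -> nat) (k l : d.-tuple int).

Local Notation mu := (@torus_measure R d).

(** The frequencies [k] with [0 <= k j < N j], as a finite type. *)
Definition box N : finType := {dffun forall j : 'I_d, 'I_(N j)}.

Definition box_freq N (b : box N) : d.-tuple int := [tuple (b j : nat)%:Z | j < d].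

Lemma card_box N : #|box N| = (\prod_(j < d) N j)%N.
Proof.
rewrite card_dep_ffun foldrE big_map big_enum /=.
by apply: eq_bigr => j _; rewrite card_ord.
Qed.

Lemma box_freq_inj N : injective (@box_freq N).
Proof.
move=> a b ab; apply/ffunP => j; apply/val_inj.
have := congr1 (fun k => tnth k j) ab.
by rewrite !tnth_mktuple => -[].
Qed.

(** Nikolskii's inequality between the maximum and the quadratic mean: combine
    the Cauchy-Schwarz inequality for the coefficients with Parseval. *)
Lemma nikolskii N (f : rpoint R d -> R[i]) (x : rpoint R d) :
  trigp (fun k => forall j, 0 <= tnth k j < (N j)%:Z) f ->
  Normc.normc (f x) ^+ 2
  <= (\prod_(j < d) N j)%:R * mean mu (fun y => Normc.normc (f y) ^+ 2).
Proof.
move=> [s sP /funext ->].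
pose r := undup [seq a.1 | a <- s].
pose c k : R[i] := \sum_(a <- s | a.1 == k) a.2.
have ur : uniq r := undup_uniq _.
have E y : tpoly s y = \sum_(k <- r) c k * chr k y.
  rewrite /tpoly -(sum_regroup (r := r) (key := fst) predT)//; last first.
    by move=> a ais; rewrite mem_undup map_f.
  by apply: eq_bigr => k _; rewrite big_distrl/=; apply: eq_bigr => a /eqP ->.
rewrite (funext E : tpoly s = _) parseval//.
have h1 : Normc.normc (\sum_(k <- r) c k * chr k x) ^+ 2
    <= (\sum_(k <- r) Normc.normc (c k)) ^+ 2.
  rewrite ler_sqr ?nnegrE ?normc_ge0 ?sumr_ge0//; last by move=> *; exact: normc_ge0.
  rewrite (le_trans (normc_sum _ _ _))// ler_sum// => k _.
  by rewrite Normc.normcM normc_chr mulr1.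
apply: (le_trans h1); apply: (le_trans (sqr_sum_le _ _)).
apply: ler_wpM2r; first by rewrite sumr_ge0// => k _; exact: sqr_ge0.
rewrite ler_nat -card_box.
rewrite cardE -(size_map (@box_freq N)); apply: uniq_leq_size => // k.
rewrite mem_undup => /mapP[a /sP Na ->]; apply/mapP.
have Nj j : (absz (tnth a.1 j) < N j)%N.
  by have /andP[] := Na j; case: (tnth a.1 j).
exists [ffun j => Ordinal (Nj j)]; first by rewrite mem_enum.
apply: eq_from_tnth => j; rewrite tnth_mktuple ffunE/=.
by have /andP[/gez0_abs -> _] := Na j.
Qed.

(** There are more frequencies in the box than points to be annihilated. *)
Lemma annihilator N (pts : seq (rpoint R d)) : (size pts < \prod_(j < d) N j)%N ->
  exists2 c : box N -> R[i], (exists b, c b != 0) &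
    forall y, y \in pts -> \sum_b c b * chr (box_freq b) y = 0.
Proof.
rewrite -card_box => hs.
pose A := \matrix_(i < #|box N|, j < size pts)
   chr (box_freq (enum_val i)) (tnth (in_tuple pts) j) : 'M[R[i]]_(_, _).
have kA : kermx A != 0.
  rewrite kermx_eq0 /row_free; apply: contraTneq hs => <-.
  by rewrite -leqNgt rank_leq_col.
have /rowV0Pn[v /sub_kermxP vA /rV0Pn[i vi]] := kA.
exists (fun b => v ord0 (enum_rank b)); first by exists (enum_val i); rewrite enum_valK.
move=> y yp; have yi : (index y pts < size pts)%N by rewrite index_mem.
pose j := Ordinal yi.
have yj : y = tnth (in_tuple pts) j by rewrite (tnth_nth y) /= nth_index.
have /matrixP/(_ ord0 j) := vA.
rewrite !mxE (reindex_onto (@enum_rank (box N)) enum_val)/=; last first.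
  by move=> b _; rewrite enum_valK.
move=> vA0; rewrite -[RHS]vA0; apply: eq_big => [b|b _]; first by rewrite enum_rankK eqxx.
by rewrite !mxE enum_rankK yj.
Qed.

End boxes.

Section degrees.
Context {R : realType} {d : nat}.
Implicit Types (N M : 'I_d -> nat) (k l : d.-tuple int).
Implicit Types (f g : rpoint R d -> R[i]).

(** Trigonometric polynomials with nonnegative frequencies, of degree at most
    [M j] in the [j]-th variable. *)
Definition degle M f :=
  trigp (fun k => forall j, 0 <= tnth k j <= (M j)%:Z) f.

Lemma degleM M N f g : degle M f -> degle N g ->
  degle (fun j => M j + N j)%N (fun x => f x * g x).
Proof.
apply: trigpM => k l hk hl j; rewrite tnth_mktuple.
by have := hk j; have := hl j; lia.
Qed.

Lemma degle_sub M N f : (forall j, M j <= N j)%N -> degle M f -> degle N f.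
Proof. by move=> MN; apply: trigp_sub => k hk j; have := hk j; have := MN j; lia. Qed.

Lemma degle_cst M (c : R[i]) : degle M (fun=> c).
Proof.
apply: (@eq_trigp _ _ _ (fun x => c * chr [tuple 0 | j < d] x)).
  move=> x; rewrite /chr /dotp big1 ?expi0 ?mulr1// => j _.
  by rewrite tnth_mktuple mul0r.
by apply: trigp_chr => j; rewrite tnth_mktuple; lia.
Qed.

Lemma degle_prod (r : seq 'I_d) (M : 'I_d -> 'I_d -> nat)
    (f : 'I_d -> rpoint R d -> R[i]) :
  (forall i, degle (M i) (f i)) ->
  degle (fun j => \sum_(i <- r) M i j)%N (fun x => \prod_(i <- r) f i x).
Proof.
move=> hf; elim: r => [|i r IH].
  by under [X in degle _ X]eq_fun do rewrite big_nil; exact: degle_cst.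
under [X in degle _ X]eq_fun do rewrite big_cons.
by apply: (degle_sub _ (degleM (hf i) IH)) => j; rewrite big_cons.
Qed.

(** The frequency [m] in the [j]-th variable. *)
Definition mono (j : 'I_d) (m : int) : d.-tuple int :=
  [tuple if i == j then m else 0 | i < d].

Lemma chr_mono j m (x : rpoint R d) : chr (mono j m) x = expi (m%:~R * tnth x j).
Proof.
rewrite /chr /dotp (bigD1 j)//= big1 ?addr0 => [|i /negbTE ij].
  by rewrite tnth_mktuple eqxx.
by rewrite tnth_mktuple ij mul0r.
Qed.

(** A product of one polynomial in each variable. *)
Lemma degle_tensor M (f : 'I_d -> rpoint R d -> R[i]) :
  (forall i, degle (fun j => if j == i then M i else 0%N) (f i)) ->
  degle M (fun x => \prod_i f i x).
Proof.
move=> /(degle_prod (index_enum 'I_d)); apply: degle_sub => j.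
by rewrite -big_mkcond/= (big_pred1 j)// => i; rewrite eq_sym.
Qed.

End degrees.

(** * Fejer kernels *)

Section fejer.
Context {R : realType} {d : nat}.
Implicit Types (N : 'I_d -> nat) (y x : rpoint R d).

Local Notation mu := (@torus_measure R d).
Local Notation circle := (uniform_prob (@pi2_gt0 R)).

(** The normalized one-sided Dirichlet kernel, of value 1 at 0. *)
Definition dir1 (n : nat) (t : R) : R[i] :=
  n%:R^-1 * \sum_(i < n) expi ((i : nat)%:~R * t).

Definition dir N y x : R[i] := \prod_(j < d) dir1 (N j) (tnth x j - tnth y j : R).

(** The product of one-dimensional Fejer kernels, of value 1 at [y]. *)
Definition fejer N y x : R := Normc.normc (dir N y x) ^+ 2.

Lemma normc_nat (n : nat) : Normc.normc (n%:R : R[i]) = n%:R.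
Proof. by rewrite -(rmorph_nat (real_complex R)) normc_real ger0_norm. Qed.

Lemma normc_dir1_le1 n t : Normc.normc (dir1 n t) <= 1.
Proof.
rewrite /dir1 Normc.normcM Normc.normcV normc_nat.
case: n => [|n]; first by rewrite invr0 mul0r ler01.
rewrite mulrC ler_pdivrMr ?ltr0Sn// mul1r (le_trans (normc_sum _ _ _))//.
under eq_bigr do rewrite normc_expi.
by rewrite sumr_const card_ord.
Qed.

Lemma dir1_0 n : (0 < n)%N -> dir1 n 0 = 1.
Proof.
move=> n0; rewrite /dir1; under eq_bigr do rewrite mulr0 expi0.
by rewrite sumr_const card_ord mulVf// pnatr_eq0 -lt0n.
Qed.

Lemma normc_dir_le1 N y x : Normc.normc (dir N y x) <= 1.
Proof.
rewrite /dir normc_prod; apply: prodr_ile1 => j _.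
by rewrite normc_ge0 normc_dir1_le1.
Qed.

Lemma dir_center N y : (forall j, 0 < N j)%N -> dir N y y = 1.
Proof. by move=> N0; rewrite /dir big1// => j _; rewrite subrr dir1_0. Qed.

Lemma dir1_shift n (y t : R) : dir1 n (t - y) =
  \sum_(i < n) (n%:R^-1 * expi (- ((i : nat)%:~R * y))) * expi ((i : nat)%:~R * t).
Proof.
rewrite /dir1 big_distrr/=; apply: eq_bigr => i _.
by rewrite -mulrA -expiD mulrBr addrC.
Qed.

Lemma cbmeas_dir1 n (y : R) : cbmeas (fun t : measurableTypeR R => dir1 n (t - y)).
Proof.
under eq_fun do rewrite dir1_shift.
by apply: cbmeas_sum => i; apply: cbmeasM; [exact: cbmeas_cst|exact: cbmeas_expi].
Qed.

Lemma cmean_dir1 n (y : R) :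
  cmean circle (fun t => dir1 n (t - y) * (dir1 n (t - y))^*%C) = n%:R^-1.
Proof.
case: n => [|n].
  by under [X in cmean _ X]eq_fun do rewrite dir1_shift big_ord0 mul0r;
    rewrite cmean_cst invr0.
have cM (z w : R[i]) : (z * w)^*%C = z^*%C * w^*%C := rmorphM _ z w.
pose c (i : 'I_n.+1) : R[i] := n.+1%:R^-1 * expi (- ((i : nat)%:~R * y)).
have E t : dir1 n.+1 (t - y) * (dir1 n.+1 (t - y))^*%C =
  \sum_(i < n.+1) \sum_(l < n.+1) (c i * (c l)^*%C) * expi ((i%:Z - l%:Z)%:~R * t).
  rewrite dir1_shift rmorph_sum big_distrlr/=.
  apply: eq_bigr => i _; apply: eq_bigr => l _.
  by rewrite cM mulrACA -expiN -expiD intrB mulrBl.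
under [X in cmean _ X]eq_fun do rewrite E.
have b i l : cbmeas (fun t : measurableTypeR R => c i * (c l)^*%C * expi ((i%:Z - l%:Z)%:~R * t)).
  by apply: cbmeasM; [exact: cbmeas_cst|exact: cbmeas_expi].
rewrite cmean_sum => [|i]; last exact: cbmeas_sum.
have cc i : c i * (c i)^*%C = n.+1%:R^-1 ^+ 2.
  rewrite /c cM -expiN mulrACA -expiD opprK addNr expi0 mulr1.
  by rewrite conjc_inv conjc_nat expr2.
transitivity (\sum_(i < n.+1) (n.+1%:R^-1 ^+ 2 : R[i])).
  apply: eq_bigr => i _; rewrite cmean_sum// (bigD1 i)//= big1 ?addr0 => [|l li].
    by rewrite (cmeanZ _ _ (cbmeas_expi _)) cmean_circle_expi subrr mulr1 cc.
  rewrite (cmeanZ _ _ (cbmeas_expi _)) cmean_circle_expi subr_eq0.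
  by rewrite eqz_nat eq_sym (inj_eq val_inj) (negbTE li) mulr0.
by rewrite sumr_const card_ord -[LHS]mulr_natl expr2 mulrA divff ?mul1r// pnatr_eq0.
Qed.

Lemma degle_dir N y : (forall j, 0 < N j)%N -> degle (fun j => (N j).-1) (dir N y).
Proof.
move=> N0; apply: degle_tensor => j.
apply: (eq_trigp (fun x => esym (dir1_shift (N j) (tnth y j) (tnth x j)))).
apply: trigp_sum => i _.
apply: (eq_trigp (f := fun x => (N j)%:R^-1 * expi (- ((i : nat)%:~R * tnth y j))
    * chr (mono j i) x)); first by move=> x; rewrite /= chr_mono.
apply: trigp_chr => l; rewrite tnth_mktuple.
by case: eqP => // _; have := ltn_ord i; lia.
Qed.

Lemma cbmeas_dir N y : (forall j, 0 < N j)%N -> cbmeas (dir N y).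
Proof. by move=> /(degle_dir y) /trigp_cbmeas. Qed.

Lemma bmeas_fejer N y : (forall j, 0 < N j)%N -> bmeas (fejer N y).
Proof. by move=> N0; apply: bmeas_sqr_normc; exact: cbmeas_dir. Qed.

Lemma fejer_ge0 N y x : 0 <= fejer N y x.
Proof. exact: sqr_ge0. Qed.

Lemma fejer_le1 N y x : fejer N y x <= 1.
Proof. by rewrite /fejer expr_le1// ?normc_ge0// normc_dir_le1. Qed.

Lemma mean_fejer N y : (forall j, 0 < N j)%N ->
  mean mu (fejer N y) = \prod_(j < d) (N j)%:R^-1.
Proof.
move=> N0; apply: (@complexI R).
rewrite -(cmean_sqr_normc mu (cbmeas_dir y N0)) rmorph_prod/=.
have E x : dir N y x * (dir N y x)^*%C = \prod_(j < d)
   (dir1 (N j) (tnth x j - tnth y j : R) * (dir1 (N j) (tnth x j - tnth y j : R))^*%C).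
  by rewrite /dir rmorph_prod -big_split.
under eq_fun do rewrite E.
rewrite (cmean_torus_prod (g := fun j (t : measurableTypeR R) => dir1 (N j) (t - tnth y j : R) *
   (dir1 (N j) (t - tnth y j : R))^*%C)); last first.
  by move=> j; apply: cbmeasM; [|apply: cbmeas_conj]; exact: cbmeas_dir1.
by apply: eq_bigr => j _; rewrite cmean_dir1 fmorphV rmorph_nat.
Qed.

(** Pointwise, the product of two Fejer kernels is below a single one, with
    the larger number of frequencies in each variable. *)
Lemma mean_fejerM N M y z : (forall j, 0 < N j)%N -> (forall j, 0 < M j)%N ->
  mean mu (fun x => fejer N y x * fejer M z x)
  <= \prod_(j < d) (maxn (N j) (M j))%:R^-1.
Proof.
move=> N0 M0.
pose L j := maxn (N j) (M j).
pose w : rpoint R d := [tuple if (M j <= N j)%N then tnth y j else tnth z j | j < d].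
have L0 j : (0 < L j)%N by rewrite leq_max N0.
rewrite -(mean_fejer w L0); apply: le_mean.
- by apply: bmeasM; exact: bmeas_fejer.
- exact: bmeas_fejer.
move=> x; rewrite /fejer /dir !normc_prod -!prodrXl -big_split/=.
apply: ler_prod => j _; rewrite mulr_ge0 ?sqr_ge0//= tnth_mktuple /L.
have le1 n t : Normc.normc (dir1 n t) ^+ 2 <= 1.
  by rewrite expr_le1// ?normc_ge0// normc_dir1_le1.
case: leqP => h; first by rewrite ler_piMr ?sqr_ge0.
by rewrite ler_piMl ?sqr_ge0.
Qed.

End fejer.

(** * Localized polynomials vanishing on the net *)

Section bumps.
Context {R : realType} {d : nat}.
Implicit Types (N M : 'I_d -> nat) (k l : d.-tuple int) (x y : rpoint R d).

Local Notation mu := (@torus_measure R d).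

(** For [N j = 2 ^ s j] this is [wfun s] times a nonvanishing function, chosen
    for all frequencies to be nonnegative. *)
Definition wpoly N x : R[i] :=
  \prod_(j < d) (1 - expi ((2 * N j)%N%:~R * tnth x j : R)).

Lemma wpoly_zero (s : d.-tuple nat) x :
  wfun s x = 0 -> wpoly (fun j => 2 ^ tnth s j)%N x = 0.
Proof.
move=> /eqP; rewrite /wfun => /prodf_eq0[j _ /eqP h].
apply/eqP/prodf_eq0; exists j => //.
rewrite PoszM rmorphM/= -mulrA (_ : 2%:~R = 1 + 1)// mulrDl mul1r expiD.
set a := _ * tnth x j.
have sa : sin a = 0 by rewrite -h /a -natrX.
have ca := cos2Dsin2 a.
have -> : expi a * expi a = 1.
  by apply: complex_ext; rewrite ?ReM ?ImM /= sa ?mulr0 ?mul0r ?addr0 ?subr0//;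
    move: ca; rewrite sa expr0n addr0 expr2.
by rewrite subrr.
Qed.

Lemma degle_wpoly N : degle (fun j => 2 * N j)%N (wpoly N).
Proof.
apply: degle_tensor => j.
apply: (eq_trigp (f := fun x => 1 + (-1) * chr (mono j (2 * N j)%N) x)).
  by move=> x; rewrite chr_mono mulN1r.
apply: trigpD; first exact: degle_cst.
by apply: trigp_chr => l; rewrite tnth_mktuple; case: eqP => // _; rewrite lexx.
Qed.

(** Apart from its constant term, [wpoly N] only has frequencies outside of the
    box of [N]; a product with a polynomial of the box is thus not zero. *)
Lemma wpoly_tail N : exists2 g,
  trigp (fun k => (forall j, 0 <= tnth k j) /\ exists j, (2 * N j)%N%:Z <= tnth k j) g &
  forall x, wpoly N x = 1 + g x.
Proof.
set P := fun k => _.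
have PP k l : P k -> (forall j, 0 <= tnth l j) -> P (addk k l).
  move=> [k0 [j kj]] l0; split=> [i|]; first by rewrite tnth_mktuple addr_ge0.
  by exists j; rewrite tnth_mktuple; have := l0 j; lia.
rewrite /wpoly; elim: (index_enum 'I_d) => [|j r [g Pg Eg]].
  by exists (fun=> 0); [exact: trigp0|move=> x; rewrite big_nil addr0].
pose e x := (-1) * @chr R d (mono j (2 * N j)%N) x.
have Pe : trigp P e.
  apply: trigp_chr; split=> [i|]; first by rewrite tnth_mktuple; case: eqP.
  by exists j; rewrite tnth_mktuple eqxx.
exists (fun x => (g x + e x) + g x * e x).
  apply: trigpD; first exact: trigpD.
  by apply: (trigpM _ Pg Pe) => k l Pk [l0 _]; exact: PP.
move=> x; rewrite big_cons Eg /e chr_mono; ring.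
Qed.

Lemma box_wpoly_neq0 N (c : box N -> R[i]) b0 : c b0 != 0 ->
  exists x, (\sum_b c b * chr (box_freq b) x) * wpoly N x != 0.
Proof.
move=> cb0; apply: contrapT => h0.
have z x : (\sum_b c b * chr (box_freq b) x) * wpoly N x = 0.
  by apply: contrapT => hx; apply: h0; exists x; exact/eqP.
have [g Pg Eg] := wpoly_tail N.
pose s := [seq (box_freq b, c b) | b <- index_enum (box N)].
have ts : trigp (fun k => forall j, 0 <= tnth k j) (tpoly (R := R) s).
  by exists s => // a /mapP[b _ ->] j; rewrite tnth_mktuple.
have [s' Ps' Es'] : trigp (fun k => exists j, (2 * N j)%N%:Z <= tnth k j)
    (fun x => tpoly s x * g x).
  apply: (trigpM _ ts Pg) => k l k0 [l0 [j lj]]; exists j.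
  by rewrite tnth_mktuple; have := k0 j; lia.
have E : tpoly (s ++ s') = tpoly [::].
  apply/funext => x; rewrite {1}/tpoly big_cat -!/(tpoly _ x) -Es'.
  rewrite [RHS]/tpoly big_nil -[RHS](z x) Eg [RHS]mulrDr mulr1.
  by rewrite {1 2}/tpoly !big_map.
have := fourier_coef_tpoly (s ++ s') (box_freq b0).
rewrite E fourier_coef_tpoly big_nil big_cat/= [X in _ + X]big_seq_cond.
rewrite [X in _ + X]big1 ?addr0; last first.
  move=> a /andP[/Ps'[j aj] /eqP ab]; move: aj; rewrite ab tnth_mktuple.
  by have := ltn_ord (b0 j); lia.
rewrite big_map (big_pred1 b0)/= => [c0|b]; first by rewrite -c0 eqxx in cb0.
by rewrite (inj_eq (@box_freq_inj _ N)).
Qed.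

(** The frequencies of the bump for [s] lie between [8 * 2 ^ s j] and
    [16 * 2 ^ s j], hence in the block with all the entries of [s] raised by 4. *)
Definition shift4 (s : d.-tuple nat) : d.-tuple nat := [tuple (tnth s j + 4)%N | j < d].

(** The square of the peak value 1/2, divided by the ratio [16 ^ d] of the number
    of frequencies allowed to [2 ^ norm1 s]. *)
Definition bump_cst : R := (4 * 16 ^+ d)^-1.

(** The bump vanishes at [pts] and on [wzeros s], and is localized at [y] on the
    scale of [s]; [pts] stands for the points of the net outside of [wzeros s]. *)
Lemma exists_bump (s : d.-tuple nat) (pts : seq (rpoint R d)) :
  (size pts < 2 ^ norm1 s)%N ->
  exists y, exists f : rpoint R d -> R[i],
  [/\ trigp (rho (shift4 s)) f,
      forall z, z \in pts \/ wfun s z = 0 -> f z = 0,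
      forall x, Normc.normc (f x) <= fejer (fun j => 2 ^ tnth s j)%N y x &
      bump_cst * 2^-1 ^+ norm1 s <= mean mu (fun x => Normc.normc (f x) ^+ 2)].
Proof.
pose N j := (2 ^ tnth s j)%N.
have N0 j : (0 < N j)%N by rewrite expn_gt0.
have prodN : (\prod_(j < d) N j = 2 ^ norm1 s)%N by rewrite /N -expn_sum.
rewrite -{1}prodN => /(@annihilator R d N)[c [b0 cb0] van].
pose t x := \sum_b c b * chr (box_freq b) x.
pose g x := t x * wpoly N x.
have degt : degle (fun j => (N j).-1) t.
  apply: trigp_sum => b _; apply: trigp_chr => j; rewrite tnth_mktuple.
  by have := ltn_ord (b j); have := N0 j; lia.
have degg := degleM degt (degle_wpoly N).
have [x0 gx0] : exists x, g x != 0 := box_wpoly_neq0 cb0.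
have [_ [B hB]] := bmeas_normc (trigp_cbmeas degg).
(* the supremum need not be attained for the argument: half of it suffices *)
pose E := [set Normc.normc (g x) | x in setT].
have supE : has_sup E.
  split; first by exists (Normc.normc (g x0)), x0.
  by exists B => _ [x _ <-]; rewrite (le_trans (ler_norm _))//; exact: hB.
have gE x : Normc.normc (g x) <= sup E by apply: sup_upper_bound => //; exists x.
have S0 : 0 < sup E by rewrite (lt_le_trans _ (gE x0))// normc_neq0.
have [_ [y _ <-] hy] : exists2 e, E e & sup E / 2 < e.
  have [e Ee he] := sup_adherent (divr_gt0 S0 (ltr0Sn _ 1)) supE.
  by exists e => //; move: he; rewrite {1}(splitr (sup E)) addrK.
pose K := dir N y.
pose m : d.-tuple int := [tuple (8 * N j)%N%:Z | j < d].
(* frequencies of [t], [wpoly] and the squared kernel add up to at most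
   [5 * N j], so that those of [f] lie in [8 * N j, 13 * N j] *)
pose f x := (((sup E)^-1)%:C%C * g x) * (K x * K x) * chr m x.
exists y, f.
have normf x : Normc.normc (f x) = (sup E)^-1 * Normc.normc (g x) * fejer N y x.
  rewrite /f !Normc.normcM normc_chr mulr1 normc_real ger0_norm ?invr_ge0 ?ltW//.
have degK := degle_dir y N0.
have tf : trigp (fun k => forall j, (8 * N j)%N%:Z <= tnth k j < (16 * N j)%N%:Z) f.
  have dg := degleM (degleM (degle_cst (fun=> 0%N) ((sup E)^-1)%:C%C) degg)
    (degleM degK degK).
  have tm : trigp (fun k => k = m) (chr (R := R) m).
    by apply: (eq_trigp (f := fun x => 1 * chr m x)); [move=> x; rewrite mul1r|exact: trigp_chr].
  apply: (trigpM _ dg tm) => k l hk -> j; rewrite !tnth_mktuple.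
  by have := hk j; have := N0 j; lia.
split.
- apply: trigp_sub tf => k hk j; rewrite tnth_mktuple expnD -(_ : 16 = 2 ^ 4)%N//.
  by have := hk j; rewrite /N; lia.
- move=> z zX; suff gz : g z = 0 by rewrite /f gz mulr0 !mul0r.
  case: zX => [/van tz|/wpoly_zero wz]; first by rewrite /g /t tz mul0r.
  by rewrite /g wz mulr0.
- move=> x; rewrite normf ler_piMl ?fejer_ge0// mulrC ler_pdivrMr// mul1r.
  exact: gE.
have fy : 2^-1 <= Normc.normc (f y).
  rewrite normf /fejer dir_center// Normc.normc1 expr1n mulr1 mulrC.
  by rewrite ler_pdivlMr// mulrC ltW.
have : 2^-1 ^+ 2 <= (\prod_(j < d) (16 * N j))%:R * mean mu (fun x => Normc.normc (f x) ^+ 2).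
  rewrite (le_trans _ (@nikolskii R d (fun j => 16 * N j)%N f y _))//.
    by rewrite ler_sqr ?nnegrE ?normc_ge0// invr_ge0.
  by apply: trigp_sub tf => k hk j; have := hk j; lia.
rewrite big_split/= prodN prod_nat_const card_ord natrM !natrX.
set w := mean _ _; set a := 16 ^+ d; set b := 2 ^+ _ => h.
rewrite /bump_cst exprVn -/b -/a -invfM -[leLHS]mul1r ler_pdivrMr; last first.
  by rewrite !mulr_gt0// exprn_gt0.
have -> : w * (4 * a * b) = 4 * (a * b * w) by ring.
apply: le_trans (ler_wpM2l (ler0n R 4) h).
have : 4 * 2^-1 ^+ 2 = 1 :> R by field.
by move=> ->.
Qed.

End bumps.

(** * Sums of localized functions with random signs *)

Section random_signs.
Context {R : realType} {I : finType}.

(** The combination of the [z i] with the signs prescribed by [e]. *)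
Definition signed_sum (e : {ffun I -> bool}) (z : I -> R[i]) : R[i] :=
  \sum_i (-1) ^+ (e i : bool) * z i.

(** Flipping all signs but the [i]-th one pairs sums whose half-sum has the
    modulus of [z i]; one of the two is at least as large. *)
Lemma sum_signs_powR (p : R) (z : I -> R[i]) (i : I) : 0 < p ->
  #|{ffun I -> bool}|%:R / 2 * Normc.normc (z i) `^ p
  <= \sum_(e : {ffun I -> bool}) Normc.normc (signed_sum e z) `^ p.
Proof.
move=> p0.
pose flip (e : {ffun I -> bool}) : {ffun I -> bool} :=
  [ffun l => if l == i then e l else ~~ e l].
have flipK : involutive flip.
  by move=> e; apply/ffunP => l; rewrite !ffunE; case: eqP => // _; rewrite negbK.
pose a e := Normc.normc (signed_sum e z) `^ p.
have sum2 : \sum_e a e = \sum_e a (flip e) by rewrite (reindex_inj (inv_inj flipK)).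
suff : \sum_(e : {ffun I -> bool}) Normc.normc (z i) `^ p <= \sum_e (a e + a (flip e)).
  rewrite big_split/= -sum2 sumr_const => h.
  by rewrite mulrAC ler_pdivrMr// mulr_natl [leRHS]mulr_natr mulr2n.
apply: ler_sum => e _.
have E : signed_sum e z + signed_sum (flip e) z = 2 * ((-1) ^+ (e i : bool) * z i).
  rewrite /signed_sum -big_split (bigD1 i)//= big1 ?addr0 => [|l /negbTE li].
    by rewrite ffunE eqxx mulr_natl mulr2n.
  by rewrite ffunE li; case: (e l); rewrite /= expr0 expr1; ring.
have nz : 2 * Normc.normc (z i) <=
    Normc.normc (signed_sum e z) + Normc.normc (signed_sum (flip e) z).
  rewrite (le_trans _ (le_normcD _ _))// E !Normc.normcM normc_nat.
  have -> : Normc.normc ((-1) ^+ (e i : bool) : R[i]) = 1.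
    by case: (e i); rewrite ?expr0 ?expr1 ?normcN Normc.normc1.
  by rewrite mul1r.
have [h|h] := leP (Normc.normc (z i)) (Normc.normc (signed_sum e z)).
  rewrite (le_trans (_ : _ <= a e))// ?lerDl ?powR_ge0//.
  by rewrite ge0_ler_powR ?nnegrE ?normc_ge0// ltW.
rewrite (le_trans (_ : _ <= a (flip e)))// ?lerDr ?powR_ge0//.
rewrite ge0_ler_powR ?nnegrE ?normc_ge0//; first exact: ltW.
by move: nz h; lra.
Qed.

Context {dT : measure_display} {T : measurableType dT} (P : probability T R).
Variables (f : I -> T -> R[i]) (K : I -> T -> R) (c A delta : R).
Hypotheses (bf : forall i, cbmeas (f i)) (bK : forall i, bmeas (K i)).
Hypotheses (fK : forall i x, Normc.normc (f i x) <= K i x).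
Hypotheses (K1 : forall i x, K i x <= 1).
Hypotheses (c0 : 0 < c) (c1 : c <= 1) (A0 : 0 < A).
Hypothesis f2 : forall i, c * delta <= mean P (fun x => Normc.normc (f i x) ^+ 2).
Hypothesis Kmean : forall i, mean P (K i) <= delta.
Hypothesis Kcorr : forall i,
  \sum_l mean P (fun x => K i x * K l x) <= A * delta.

(** If the [f i] are localized by almost uncorrelated [K i], some choice of signs
    makes the [p]-th moment of the sum as large as if the supports were
    disjoint. *)
Lemma signs_lower_bound (p : R) : 0 < p -> exists e : {ffun I -> bool},
  (c / 2) `^ p / 2 * (c ^+ 2 / (4 * A)) * (#|I|%:R * delta)
  <= mean P (fun x => Normc.normc (signed_sum e (f ^~ x)) `^ p).
Proof.
move=> p0; set lam := c / 2.
have lam0 : 0 <= lam by rewrite divr_ge0// ltW.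
have lam1 : lam <= 1 by move: c0 c1; rewrite /lam; lra.
pose u i x := Normc.normc (f i x).
have bu i : bmeas (u i) by exact: bmeas_normc.
have u0 i x : 0 <= u i x by exact: normc_ge0.
have u1 i x : u i x <= 1 by rewrite (le_trans (fK i x)).
(* [v i] is nonpositive where [u i < lam] and at most 1: a lower bound for the
   indicator function of [u i >= lam] *)
pose v i x := u i x ^+ 2 - lam * u i x.
have b2 i : bmeas (fun x => u i x ^+ 2) by exact: bmeas_sqr_normc.
have bl i : bmeas (fun x => lam * u i x) by apply: bmeasM => //; exact: bmeas_cst.
have bv i : bmeas (v i) by exact: bmeasB.
have bvv i l : bmeas (fun x => v i x * v l x) by exact: bmeasM.
have bKK i l : bmeas (fun x => K i x * K l x) by exact: bmeasM.
have mv i : c / 2 * delta <= mean P (v i).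
  rewrite meanB// meanZ//.
  have h1 : mean P (u i) <= delta.
    by apply: le_trans (Kmean i); apply: le_mean => // x; exact: fK.
  have := f2 i; rewrite -/(u i) => h2.
  have := ler_wpM2l lam0 h1; rewrite /lam in h2 *; move: h2.
  by rewrite (_ : c * delta = c / 2 * delta + c / 2 * delta); [lra|field].
have vK i x : `|v i x| <= K i x.
  rewrite (le_trans _ (fK i x))// -/(u i x) /v ler_norml.
  by have := u0 i x; have := u1 i x; move: (u i x) => w; nra.
pose G x := \sum_i v i x.
have bG : bmeas G by exact: bmeas_sum.
have mG : #|I|%:R * (c / 2 * delta) <= mean P G.
  rewrite mean_sum// mulr_natl -sumr_const; exact: ler_sum.
have bG2 : bmeas (fun x => G x ^+ 2) by under eq_fun do rewrite expr2; exact: bmeasM.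
have mG2 : mean P (fun x => G x ^+ 2) <= #|I|%:R * (A * delta).
  under [X in mean _ X]eq_fun do rewrite expr2 /G big_distrlr/=.
  rewrite mean_sum => [|i]; last exact: bmeas_sum.
  rewrite mulr_natl -sumr_const; apply: ler_sum => i _.
  rewrite mean_sum// (le_trans _ (Kcorr i))//; apply: ler_sum => l _.
  apply: le_mean => // x; rewrite (le_trans (ler_norm _))// normrM.
  exact: ler_pM.
set B := 2 * A / c.
have B0 : 0 < B by rewrite divr_gt0// mulr_gt0.
(* [H] is at most 1, as [1 - H] is a square, and nonpositive where [G] is: a
   lower bound for the indicator function of the union of the sets
   [u i >= lam] *)
pose H x := 2 / B * G x - B^-1 ^+ 2 * G x ^+ 2.
have bH1 : bmeas (fun x => 2 / B * G x) by apply: bmeasM => //; exact: bmeas_cst.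
have bH2 : bmeas (fun x => B^-1 ^+ 2 * G x ^+ 2) by apply: bmeasM => //; exact: bmeas_cst.
have bH : bmeas H by exact: bmeasB.
have mH : c ^+ 2 / (4 * A) * (#|I|%:R * delta) <= mean P H.
  rewrite meanB// !meanZ//.
  have h1 := ler_wpM2l (ltW (divr_gt0 (ltr0Sn R 1) B0)) mG.
  have h2 : B^-1 ^+ 2 * mean P (fun x => G x ^+ 2) <= B^-1 ^+ 2 * (#|I|%:R * (A * delta)).
    by apply: ler_wpM2l => //; exact: sqr_ge0.
  apply: le_trans (lerB h1 h2); rewrite /B le_eqVlt; apply/orP; left; apply/eqP.
  by field; rewrite !gt_eqF.
pose n2 : R := #|{ffun I -> bool}|%:R.
pose F e x := Normc.normc (signed_sum e (f ^~ x)) `^ p.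
have pointwise x : n2 / 2 * (lam `^ p) * H x <= \sum_e F e x.
  have [/existsP[i hi]|/existsPn hlam] := boolP [exists i, lam <= u i x].
    apply: le_trans (sum_signs_powR (f ^~ x) i p0); rewrite -mulrA.
    apply: ler_wpM2l; first by rewrite divr_ge0// ler0n.
    rewrite (le_trans (_ : _ <= lam `^ p))//.
      rewrite ler_piMr ?powR_ge0// /H.
      have := sqr_ge0 (1 - B^-1 * G x); rewrite sqrrB expr1n mul1r exprMn; lra.
    by rewrite ge0_ler_powR ?nnegrE ?normc_ge0//; exact: ltW.
  rewrite (le_trans (_ : _ <= 0))//; last by apply: sumr_ge0 => e _; exact: powR_ge0.
  apply: mulr_ge0_le0; first by rewrite mulr_ge0 ?powR_ge0 ?divr_ge0 ?ler0n.
  have G0 : G x <= 0.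
    apply: sumr_le0 => i _; rewrite /v expr2 -mulrBl.
    by rewrite mulr_le0_ge0// subr_le0 ltW// ltNge hlam.
  rewrite /H subr_le0 (le_trans (_ : _ <= 0))//.
    by rewrite mulr_ge0_le0// divr_ge0// ltW.
  by rewrite mulr_ge0// sqr_ge0.
have bF e : bmeas (F e).
  apply: bmeas_powR; [exact: ltW| |by move=> x; exact: normc_ge0].
  apply: bmeas_normc; apply: cbmeas_sum => i; apply: cbmeasM => //.
  exact: cbmeas_cst.
apply: contrapT => /forallNP hF.
have : n2 / 2 * (lam `^ p) * mean P H <= \sum_e mean P (F e).
  rewrite -meanZ// -mean_sum//; apply: le_mean pointwise.
    by apply: bmeasM => //; exact: bmeas_cst.
  exact: bmeas_sum.
apply/negP; rewrite -ltNge.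
have e0 : {ffun I -> bool} := [ffun=> false].
apply: (@lt_le_trans _ _ (\sum_(e : {ffun I -> bool}) (lam `^ p / 2 * mean P H))).
  apply: ltr_sum => [|e _]; first by apply/hasP; exists e0; rewrite ?mem_index_enum.
  apply: (@lt_le_trans _ _ (lam `^ p / 2 * (c ^+ 2 / (4 * A)) * (#|I|%:R * delta))).
    by rewrite ltNge; apply/negP/(hF e).
  by rewrite -mulrA; apply: ler_wpM2l => //; rewrite divr_ge0// powR_ge0.
by rewrite sumr_const -mulr_natl -/n2; rewrite le_eqVlt; apply/orP; left; apply/eqP; ring.
Qed.

End random_signs.

(** * Regularity and norms of trigonometric polynomials *)

Section regularity.
Context {R : realType} {d : nat}.

Lemma real_complex_continuous : continuous (fun r : R => (r%:C%C : R[i]^o)).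
Proof.
move=> r; apply/cvgrPdist_lt => e; rewrite ltcE => /andP[/eqP ime re].
have -> : e = (complex.Re e)%:C%C by case: e ime re => a b /= ->.
near=> s; rewrite -rmorphB/= normc_def /= expr0n addr0 sqrtr_sqr ltcR.
near: s; exact: (@cvgr_dist_lt _ R^o _ _ _ id r (@cvg_id _ _)).
Unshelve. all: by end_near. Qed.

Lemma complex_continuousD (T : topologicalType) (f g : T -> R[i]) (x : T) :
  {for x, continuous (f : T -> R[i]^o)} -> {for x, continuous (g : T -> R[i]^o)} ->
  {for x, continuous ((fun y => f y + g y) : T -> R[i]^o)}.
Proof. by move=> cf cg; exact: (@continuousD _ R[i]^o T f g x cf cg). Qed.

Lemma complex_continuousZ (T : topologicalType) (c : R[i]) (f : T -> R[i]) (x : T) :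
  {for x, continuous (f : T -> R[i]^o)} ->
  {for x, continuous ((fun y => c * f y) : T -> R[i]^o)}.
Proof. by move=> cf; exact: (@cvgZl_tmp _ R[i]^o T _ _ c f (f x) cf). Qed.

Lemma expi_continuous : continuous (fun r : R => (expi r : R[i]^o)).
Proof.
have -> : (fun r : R => expi r) = (fun r => (cos r)%:C%C + 'i%C * (sin r)%:C%C).
  by apply/funext => r; rewrite {1}(complexE (expi r)).
move=> r.
apply: (@complex_continuousD _ (fun r => (cos r)%:C%C) (fun r => 'i%C * (sin r)%:C%C)).
  apply: (@continuous_comp _ _ _ cos (fun r : R => (r%:C%C : R[i]^o))).
    exact: continuous_cos.
  exact: real_complex_continuous.
apply: (@complex_continuousZ _ 'i%C (fun r => (sin r)%:C%C)).
apply: (@continuous_comp _ _ _ sin (fun r : R => (r%:C%C : R[i]^o))).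
  exact: continuous_sin.
exact: real_complex_continuous.
Qed.

Lemma tpoly_continuous s : torus_continuous (@tpoly R d s).
Proof.
have clin k (r : seq 'I_d) :
    continuous (fun v : 'rV[R]_d => \sum_(j <- r) (tnth k j)%:~R * v ord0 j).
  elim: r => [|j r IHr].
    have -> : (fun v : 'rV[R]_d => \sum_(j <- [::]) (tnth k j)%:~R * v ord0 j) = cst 0.
      by apply/funext => v; rewrite big_nil.
    exact: cst_continuous.
  pose f (v : 'rV[R]_d) : R := (tnth k j)%:~R * v ord0 j.
  have cf : continuous f.
    move=> v; apply: (@continuousM R _ (cst (tnth k j)%:~R) (fun v : 'rV[R]_d => v ord0 j)).
      exact: cst_continuous.
    exact: coord_continuous.
  pose g (v : 'rV[R]_d) : R := \sum_(i <- r) (tnth k i)%:~R * v ord0 i.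
  have -> : (fun v : 'rV[R]_d => \sum_(i <- j :: r) (tnth k i)%:~R * v ord0 i) = f \+ g.
    by apply/funext => v; rewrite big_cons.
  by move=> v; apply: (continuousD (cf v)); exact: IHr.
have cdot k : continuous (fun v : 'rV[R]_d => dotp k [tuple v ord0 i | i < d] : R).
  have -> : (fun v : 'rV[R]_d => dotp k [tuple v ord0 i | i < d] : R)
    = (fun v => \sum_(j < d) (tnth k j)%:~R * v ord0 j).
    by apply/funext => v; apply: eq_bigr => j _; rewrite tnth_mktuple.
  exact: clin.
rewrite /torus_continuous /tpoly; elim: s => [|a s IH].
  by under eq_fun do rewrite big_nil; exact: cst_continuous.
under eq_fun do rewrite big_cons.
move=> v; apply: (@complex_continuousD _ (fun v : 'rV[R]_d =>
  a.2 * chr a.1 [tuple v ord0 i | i < d]) (fun v : 'rV[R]_d =>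
  tpoly s [tuple v ord0 i | i < d])); last exact: IH.
apply: (@complex_continuousZ _ a.2 (fun v : 'rV[R]_d => chr a.1 [tuple v ord0 i | i < d])).
apply: (@continuous_comp _ _ _ (fun v : 'rV[R]_d => dotp a.1 [tuple v ord0 i | i < d] : R)
  (fun r : R => (expi r : R[i]^o))); first exact: cdot.
exact: expi_continuous.
Qed.

Lemma chr_periodic k : Defs.periodic (@chr R d k).
Proof.
move=> j x; rewrite /chr (_ : dotp k (shift2pi j x) = dotp k x + (tnth k j)%:~R * (2 * pi)).
  by rewrite expiD expi_int2pi mulr1.
rewrite /dotp [RHS]addrC (bigD1 j)//= [in RHS](bigD1 j)//= addrA; congr (_ + _).
  by rewrite tnth_mktuple eqxx mulrDr addrC.
by apply: eq_bigr => i /negbTE ij; rewrite tnth_mktuple ij addr0.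
Qed.

Lemma tpoly_periodic s : Defs.periodic (@tpoly R d s).
Proof.
by move=> j x; apply: eq_bigr => a _; rewrite chr_periodic.
Qed.

Lemma cbmeas_Lpnorm (p : R) (f : rpoint R d -> R[i]) : 0 < p -> cbmeas f ->
  Lpnorm p f = ((mean (torus_measure d) (fun x => Normc.normc (f x) `^ p)) `^ p^-1)%:E.
Proof.
move=> p0 bf; apply: Lnorm_mean => //; first exact: bmeas_normc.
by move=> x; exact: normc_ge0.
Qed.

Lemma trigp_in_Lp (p : R) P (f : rpoint R d -> R[i]) : 0 < p -> trigp P f -> in_Lp p f.
Proof.
move=> p0 tf; have bf := trigp_cbmeas tf; have [[mr _] [mi _]] := bf.
split=> //; last by rewrite cbmeas_Lpnorm// ltry.
by case: tf => s _ /funext ->; exact: tpoly_periodic.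
Qed.

End regularity.

(** * Sums over the family of blocks *)

(** An infinite sum supported by the injective image of a finite type. *)
Lemma esum_finite_support (R : realType) (T : choiceType) (I : finType)
    (g : I -> T) (f : T -> \bar R) (c : R) : injective g ->
  (forall s, (forall i, g i != s) -> f s = 0%E) ->
  (forall i, (0 <= f (g i) <= c%:E)%E) ->
  (\esum_(s in setT) f s <= (#|I|%:R * c)%:E)%E.
Proof.
move=> gI f0 fc.
have -> : (\esum_(s in setT) f s = \esum_(s in range g) f s)%E.
  rewrite [RHS]esum_mkcond; apply: eq_esum => s _; case: ifPn => //.
  rewrite notin_setE/= => h; apply: f0 => i; apply/eqP => gis.
  by apply: h; exists i.
rewrite esum_image; last by move=> i j _ _; exact: gI.
rewrite (esum_fset finite_finset) => [|i _]; last by case/andP: (fc i).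
have -> : [set: I] = [set` index_enum I].
  by apply/seteqP; split=> i _ //=; rewrite mem_index_enum.
rewrite -fsbig_seq ?index_enum_uniq//.
apply: (@le_trans _ _ (\sum_(i : I) c%:E)%E).
  by apply: lee_sum => i _; case/andP: (fc i).
by rewrite sumEFin lee_fin sumr_const mulr_natl.
Qed.

(** The condition on the net, with the points outside of [wzeros s] listed. *)
Lemma net_points (R : realType) d m (xi : 'I_m -> rpoint R d) n (s : d.-tuple nat) :
  (0 < n)%N -> is_net xi n (n - 1) -> norm1 s = n ->
  exists2 pts : seq (rpoint R d), (size pts < 2 ^ norm1 s)%N &
    forall j, xi j \in pts \/ wfun s (xi j) = 0.
Proof.
move=> n0 net sn; have hc := net s sn.
set A := range xi `\` wzeros s in hc.
exists (finmap.enum_fset (fset_set A)).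
  rewrite (leq_ltn_trans (geq_card_fset_set hc))// sn ltn_exp2l//; lia.
move=> j; have [|wj] := pselect (wfun s (xi j) = 0); [by right|left].
rewrite in_fset_set; first by apply/mem_set; split=> //; exists j.
apply: (@sub_finite_set _ _ (range xi)); last exact: finite_image finite_finset. 
exact: subDsetl.
Qed.

Section block_family.
Variables (d n B : nat).
Hypothesis dBn : (d * B <= n + d)%N.

(** The block whose coordinates other than the first one are the values of [a],
    and whose coordinates sum up to [n]. *)
Definition block (a : {ffun 'I_d -> 'I_B}) : d.+1.-tuple nat :=
  [tuple if unlift ord0 j is Some i then a i : nat else (n - \sum_i a i)%N | j < d.+1].

Lemma block0 a : tnth (block a) ord0 = (n - \sum_i a i)%N.
Proof. by rewrite tnth_mktuple unlift_none. Qed.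

Lemma block_lift a i : tnth (block a) (lift ord0 i) = a i.
Proof. by rewrite tnth_mktuple liftK. Qed.

Lemma norm1_block a : norm1 (block a) = n.
Proof.
rewrite /norm1 big_ord_recl block0 (eq_bigr _ (fun i _ => block_lift a i)).
rewrite subnK//.
have : (\sum_(i < d) a i <= \sum_(i < d) B.-1)%N.
  by apply: leq_sum => i _; have := ltn_ord (a i); lia.
rewrite sum_nat_const card_ord => /leq_trans; apply.
by case: B dBn => [|b]; nia.
Qed.

Lemma block_inj : injective block.
Proof.
move=> a b ab; apply/ffunP => i; apply/val_inj.
by rewrite /= -!block_lift ab.
Qed.

(** The sum of the maxima is [n] plus half of the [l_1] distance of the two
    blocks, which is at least the distance of [a] and [b]. *)
Lemma block_max (a b : {ffun 'I_d -> 'I_B}) :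
  (2 * n + \sum_i ((a i - b i) + (b i - a i)) <=
   2 * \sum_j maxn (tnth (block a) j) (tnth (block b) j))%N.
Proof.
have na := norm1_block a; have nb := norm1_block b.
rewrite /norm1 in na nb.
rewrite big_ord_recl block0 (eq_bigr _ (fun i _ => block_lift a i)) in na.
rewrite big_ord_recl block0 (eq_bigr _ (fun i _ => block_lift b i)) in nb.
rewrite [in leqRHS]big_ord_recl !block0 mulnDr.
have -> : (2 * (\sum_(i < d) maxn (tnth (block a) (lift ord0 i)) (tnth (block b) (lift ord0 i)))
   = \sum_(i < d) a i + \sum_(i < d) b i + \sum_i ((a i - b i) + (b i - a i)))%N.
  rewrite -!big_split/= big_distrr/=; apply: eq_bigr => i _.
  by rewrite !block_lift; lia.
move: na nb => /=; set A := (\sum_i a i)%N; set B' := (\sum_i b i)%N.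
set D := (\sum_i _)%N; lia.
Qed.

Variable R : realType.

Lemma geom_two_sided (x : nat) :
  \sum_(z < B) (3 / 4 : R) ^+ ((x - z) + (z - x)) <= 8.
Proof.
set rho := (3 / 4 : R); pose S m := \sum_(z < m) rho ^+ ((x - z) + (z - x)).
have r0 k : 0 <= rho ^+ k by rewrite exprn_ge0 /rho//; lra.
have r1 k : rho ^+ k <= 1 by rewrite exprn_ile1 /rho//; lra.
(* closed bounds for the partial sums, on each side of [x] *)
have H m : if (m <= x)%N then S m <= 3 * rho ^+ (x - m) else S m <= 8 - 4 * rho ^+ (m - x).
  elim: m => [|m IH]; first by rewrite leq0n /S big_ord0 mulr_ge0.
  rewrite /S big_ord_recr/= -/(S m).
  case: ltngtP IH => // mx IH.
  - rewrite (_ : (m - x = 0)%N) ?addn0; last lia.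
    have -> : (x - m = (x - m.+1).+1)%N by lia.
    move: IH; have -> : (x - m = (x - m.+1).+1)%N by lia.
    by rewrite exprS; move: (rho ^+ _) => w; rewrite /rho; lra.
  - rewrite (_ : (x - m = 0)%N) ?add0n; last lia.
    by rewrite subSn ?exprS; [move: IH; move: (rho ^+ _) => w; rewrite /rho; lra|lia].
  - rewrite mx subnn subSnn addn0 expr0 expr1; move: IH.
    by rewrite mx subnn expr0 /rho; lra.
have := H B; rewrite -/(S B); case: ifP => _ h; apply: le_trans h _.
  by have := r1 (x - B)%N; lra.
by have := r0 (B - x)%N; lra.
Qed.

(** The correlations decay geometrically with the distance of the blocks. *)
Lemma block_correlation a :
  \sum_b \prod_(j < d.+1) (maxn (2 ^ tnth (block a) j) (2 ^ tnth (block b) j))%:R^-1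
  <= 8 ^+ d * 2^-1 ^+ n :> R.
Proof.
have h b : \prod_(j < d.+1) (maxn (2 ^ tnth (block a) j) (2 ^ tnth (block b) j))%:R^-1
   <= 2^-1 ^+ n * \prod_(i < d) (3 / 4 : R) ^+ ((a i - b i) + (b i - a i)).
  set E := (\sum_j maxn (tnth (block a) j) (tnth (block b) j))%N.
  have -> : \prod_(j < d.+1) (maxn (2 ^ tnth (block a) j) (2 ^ tnth (block b) j))%:R^-1
      = 2^-1 ^+ E :> R.
    rewrite /E -prodrXr; apply: eq_bigr => j _.
    rewrite exprVn -natrX; congr (_%:R^-1).
    by case: (leqP (tnth (block a) j) (tnth (block b) j)) => hj;
      apply/maxn_idPr || apply/maxn_idPl; rewrite leq_exp2l// ltnW.
  rewrite prodrXr; set D := (\sum_i _)%N.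
  have ED : (2 * n + D <= 2 * E)%N by exact: block_max.
  have nE : (n <= E)%N by lia.
  rewrite -(subnKC nE) exprD; apply: ler_wpM2l; first by rewrite exprn_ge0// invr_ge0.
  (* 1/2 is at most the square of 3/4, which absorbs the factor 1/2 in
     [D / 2 <= E - n] *)
  apply: (@le_trans _ _ (((3 / 4) ^+ 2) ^+ (E - n))).
    by rewrite lerXn2r ?nnegrE//; lra.
  by rewrite -exprM ler_wiXn2l//; [lra|lia].
rewrite (le_trans (ler_sum _ (fun b _ => h b)))// -big_distrr/= mulrC.
apply: ler_wpM2r; first by rewrite exprn_ge0// invr_ge0.
rewrite -(bigA_distr_bigA (fun (i : 'I_d) (z : 'I_B) => (3 / 4 : R) ^+ ((a i - z) + (z - a i)))).
rewrite -[X in _ <= 8 ^+ X](card_ord d) -prodr_const.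
apply: ler_prod => i _; rewrite geom_two_sided andbT.
by apply: sumr_ge0 => z _; rewrite exprn_ge0//; lra.
Qed.

End block_family.

(** * Assembling the fooling function *)

Section powers.
Context {R : realType}.
Implicit Types a b x y p : R.

Lemma powR_expVn n : (2^-1 : R) ^+ n = 2 `^ (- n%:R).
Proof. by rewrite powRN powR_mulrn// exprVn. Qed.

(** Powers of comparable quantities are comparable, whatever the sign of the
    exponent. *)
Lemma powR_comparable (D x y E : R) : 0 < D -> 0 < x -> 0 < y ->
  x <= D * y -> y <= D * x -> D `^ (- `|E|) * y `^ E <= x `^ E.
Proof.
move=> D0 x0 y0 xy yx; have [E0|E0] := leP 0 E.
  rewrite ger0_norm// powRN mulrC ler_pdivrMr ?powR_gt0//.
  rewrite -(powRM _ (ltW x0) (ltW D0)) mulrC.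
  by apply: ge0_ler_powR => //; rewrite nnegrE ltW// mulr_gt0.
rewrite ltr0_norm// opprK -(powRM _ (ltW D0) (ltW y0)).
have : 0 <= - E by rewrite oppr_ge0 ltW.
have powE z : z `^ E = (z `^ (- E))^-1 by rewrite powRN invrK.
rewrite !powE => e0; rewrite lef_pV2 ?posrE ?powR_gt0 ?mulr_gt0//.
by apply: ge0_ler_powR => //; rewrite nnegrE ltW// mulr_gt0.
Qed.

End powers.

Lemma trigpZ (R : realType) d P (c : R[i]) (f : rpoint R d -> R[i]) :
  trigp P f -> trigp P (fun x => c * f x).
Proof.
move=> [s sP fs]; exists [seq (a.1, c * a.2) | a <- s].
  by move=> _ /mapP[a /sP Pa ->].
move=> x; rewrite fs /tpoly big_map big_distrr/=.
by apply: eq_bigr => a _; rewrite mulrA.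
Qed.

(** A function with [#|I|] active blocks, each of weighted norm at most
    [#|I| ^ (- 1 / theta)], has a Besov norm at most 1; the exponent is 0
    when [theta] is infinite. *)
Lemma besov_norm_le1 (R : realType) d (I : finType) (g : I -> d.-tuple nat)
    (r q : R) (theta : \bar R) (f : rpoint R d -> R[i]) :
  (1 <= theta)%E -> injective g -> 0 < #|I|%:R :> R ->
  (forall s, (forall i, g i != s) -> Lpnorm q (delta s f) = 0%E) ->
  (forall i, (Lpnorm q (delta (g i) f) * (2 `^ (r * (norm1 (g i))%:R))%:E
     <= (#|I|%:R `^ (- fine (theta^-1)%E))%:E)%E) ->
  (besov_norm r q theta f <= 1)%E.
Proof.
move=> th1 gI I0 h0 hg.
have a0 s : (0 <= Lpnorm q (delta s f) * (2 `^ (r * (norm1 s)%:R))%:E)%E.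
  by rewrite mule_ge0 ?Lnorm_ge0// lee_fin powR_ge0.
rewrite /besov_norm; case: theta th1 hg => [t| |//].
  rewrite lee_fin => t1; have t0 : 0 < t by exact: lt_le_trans t1.
  rewrite inver gt_eqF//= => hg.
  have le1 : (\esum_(s in setT)
      ((Lpnorm q (delta s f) * (2 `^ (r * (norm1 s)%:R))%:E) `^ t) <= 1%:E)%E.
    have E1 : #|I|%:R * (#|I|%:R `^ (- t^-1)) `^ t = 1 :> R.
      by rewrite -powRrM mulNr mulVf ?gt_eqF// powR_inv1 ?ltW// divff// gt_eqF.
    rewrite -[in leRHS]E1; apply: (esum_finite_support gI).
      by move=> s /h0 ->; rewrite mul0e poweR0r// gt_eqF.
    move=> i; rewrite poweR_ge0/= -[leRHS]poweR_EFin.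
    apply: (@gt0_ler_poweR _ t (ltW t0)) (hg i); rewrite ?ltW// in_itv/= ?leey ?andbT//.
  apply: (@le_trans _ _ (1 `^ t^-1)%E); last by rewrite poweR1r.
  have ti0 : 0 <= t^-1 by rewrite invr_ge0 ltW.
  apply: (@gt0_ler_poweR _ _ ti0) le1; rewrite in_itv/= ?leey ?andbT//.
  by apply: esum_ge0 => s _; exact: poweR_ge0.
rewrite invey /= oppr0 powRr0 => _ hg.
apply: ge_ereal_sup => _ [s _ <-].
have [[i <-]|hs] := pselect (exists i, g i = s); first exact: hg.
rewrite h0 ?mul0e// => i; apply/eqP => gis; apply: hs; by exists i.
Qed.

Section fooling.
Context {R : realType} (d n B m : nat) (xi : 'I_m -> rpoint R d.+1).
Hypotheses (n0 : (0 < n)%N) (B0 : (0 < B)%N) (dBn : (d * B <= n + d)%N).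
Hypothesis net : is_net xi n (n - 1).
Variables (p q r : R) (theta : \bar R).
Hypotheses (q1 : 1 <= q) (p0 : 0 < p) (th1 : (1 <= theta)%E).

Local Notation mu := (@torus_measure R d.+1).
Local Notation I := {ffun 'I_d -> 'I_B}.

(** The constant of [signs_lower_bound] for the bumps. *)
Definition Lp_cst : R :=
  (@bump_cst R d.+1 / 2) `^ p / 2 * (@bump_cst R d.+1 ^+ 2 / (4 * 8 ^+ d)).

(** The height of the bumps, for which the Besov norm of their sum is at most 1. *)
Definition height : R :=
  2 `^ (n%:R / q) * 2 `^ (- (r * (n + 4 * d.+1)%N%:R))
  * (B ^ d)%N%:R `^ (- fine (theta^-1)%E).

(** A function of the Besov ball which vanishes on the net, with a large norm
    in [L_p]. *)
Lemma fooling_function : exists F : rpoint R d.+1 -> R[i],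
  [/\ besov_ball r q theta F, torus_continuous F,
      forall j, F (xi j) = 0 &
      ((height * (Lp_cst * ((B ^ d)%N%:R * 2^-1 ^+ n)) `^ p^-1)%:E <= Lpnorm p F)%E].
Proof.
have q0 : 0 < q by exact: lt_le_trans q1.
pose blk (a : I) := @block d n B a.
have nblk a : norm1 (blk a) = n by exact: norm1_block.
have bumps (a : I) : exists yf : rpoint R d.+1 * (rpoint R d.+1 -> R[i]),
  [/\ trigp (rho (shift4 (blk a))) yf.2,
      forall j, yf.2 (xi j) = 0,
      forall x, Normc.normc (yf.2 x) <= fejer (fun j => 2 ^ tnth (blk a) j)%N yf.1 x &
      @bump_cst R d.+1 * 2^-1 ^+ n <= mean mu (fun x => Normc.normc (yf.2 x) ^+ 2)].
  have [pts hpts hxi] := net_points n0 net (nblk a).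
  have [y [f [tf f0 fK f2]]] := exists_bump hpts.
  by exists (y, f); split=> //=; [move=> j; apply: f0|rewrite -{1}(nblk a)].
have [yf hyf] := choice bumps.
pose f a := (yf a).2.
pose N2 (a : I) (j : 'I_d.+1) := (2 ^ tnth (blk a) j)%N.
have N20 a j : (0 < N2 a j)%N by rewrite expn_gt0.
pose K a := fejer (N2 a) (yf a).1.
have tf a : trigp (rho (shift4 (blk a))) (f a) by case: (hyf a).
have fxi a j : f a (xi j) = 0 by have [_ + _ _] := hyf a; exact.
have fK a x : Normc.normc (f a x) <= K a x by have [_ _ + _] := hyf a; exact.
have f2 a : @bump_cst R d.+1 * 2^-1 ^+ n <= mean mu (fun x => Normc.normc (f a x) ^+ 2).
  by have [] := hyf a.
have bf a : cbmeas (f a) := trigp_cbmeas (tf a).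
have bK a : bmeas (K a) by exact: bmeas_fejer.
have K1 a x : K a x <= 1 by exact: fejer_le1.
have half0 : 0 <= (2^-1 : R) by rewrite invr_ge0.
have Kmean a : mean mu (K a) <= 2^-1 ^+ n.
  rewrite mean_fejer// -(nblk a) /norm1 -prodrXr.
  rewrite le_eqVlt; apply/orP; left; apply/eqP; apply: eq_bigr => j _.
  by rewrite exprVn -natrX.
have c0 : 0 < @bump_cst R d.+1 by rewrite invr_gt0 mulr_gt0// exprn_gt0.
have c1 : @bump_cst R d.+1 <= 1.
  rewrite invf_le1 ?mulr_gt0 ?exprn_gt0//.
  have : 1 <= 16 ^+ d.+1 :> R by rewrite exprn_ege1// ler1n.
  lra.
have A0 : 0 < 8 ^+ d :> R by rewrite exprn_gt0.
have Kcorr a : \sum_b mean mu (fun x => K a x * K b x) <= 8 ^+ d * 2^-1 ^+ n.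
  rewrite (le_trans _ (block_correlation dBn R a))//.
  by apply: ler_sum => b _; exact: mean_fejerM.
have [e he] := signs_lower_bound bf bK fK K1 c0 c1 A0 f2 Kmean Kcorr p0.
have cardI : #|{: I}| = (B ^ d)%N by rewrite card_ffun !card_ord.
have h0 : 0 <= height by rewrite /height !mulr_ge0// powR_ge0.
have N0 : 0 < (B ^ d)%N%:R :> R by rewrite ltr0n expn_gt0 B0.
pose g a x := (height%:C%C * (-1) ^+ (e a : bool)) * f a x.
pose F x := \sum_a g a x.
have tg a : trigp (rho (shift4 (blk a))) (g a) by exact: trigpZ.
have tgT a : trigp (fun=> True) (g a) by apply: trigp_sub (tg a).
have tF : trigp (fun=> True) F by apply: trigp_sum => a _; exact: tgT.
have FE x : F x = height%:C%C * signed_sum e (f ^~ x).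
  by rewrite /F /signed_sum big_distrr/=; apply: eq_bigr => a _; rewrite /g mulrA.
have normg a x : Normc.normc (g a x) = height * Normc.normc (f a x).
  rewrite /g !Normc.normcM normc_real ger0_norm//.
  by case: (e a); rewrite ?expr0 ?expr1 ?normcN Normc.normc1 mulr1.
have deltaF s x : delta s F x = \sum_a (if shift4 (blk a) == s then g a x else 0).
  by rewrite (delta_sum _ _ _ tgT); apply: eq_bigr => a _; exact: delta_block.
have shiftI : injective (fun a => shift4 (blk a)).
  move=> a b ab; apply: (@block_inj d n B); apply: eq_from_tnth => j.
  have := congr1 (fun s => tnth s j) ab; rewrite !tnth_mktuple => /eqP.
  by rewrite eqn_add2r => /eqP.
exists F; split.
- split; first by apply: trigp_in_Lp tF.
  apply: (besov_norm_le1 th1 shiftI); first by rewrite cardI.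
    move=> s hs; have -> : delta s F = (fun=> 0).
      by apply/funext => x; rewrite deltaF big1// => a _; rewrite (negbTE (hs a)).
    rewrite cbmeas_Lpnorm//; last exact: cbmeas_cst.
    under [X in mean _ X]eq_fun do rewrite Normc.normc0 powR0 ?gt_eqF//.
    by rewrite mean_cst powR0// invr_eq0 gt_eqF.
  move=> a; have -> : delta (shift4 (blk a)) F = g a.
    apply/funext => x; rewrite deltaF (bigD1 a)//= eqxx big1 ?addr0// => b ba.
    by rewrite (inj_eq shiftI) (negbTE ba).
  have bg : cbmeas (g a) := trigp_cbmeas (tg a).
  rewrite cbmeas_Lpnorm// -EFinM lee_fin cardI.
  have -> : norm1 (shift4 (blk a)) = (n + 4 * d.+1)%N.
    rewrite -[in RHS](nblk a) /norm1 /shift4; under eq_bigr do rewrite tnth_mktuple.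
    by rewrite big_split/= sum_nat_const card_ord mulnC.
  have hm : (mean mu (fun x => Normc.normc (g a x) `^ q)) `^ q^-1
      <= height * 2 `^ (- (n%:R / q)).
    have -> : height * 2 `^ (- (n%:R / q)) = (height `^ q * 2^-1 ^+ n) `^ q^-1.
      rewrite powRM ?powR_ge0// -powRrM divff ?gt_eqF// powRr1//.
      by rewrite powR_expVn -powRrM mulNr.
    apply: ge0_ler_powR; rewrite ?invr_ge0 ?nnegrE ?(ltW q0)//.
    - by apply: mean_ge0 => x; exact: powR_ge0.
    - by rewrite mulr_ge0 ?powR_ge0.
    apply: (@le_trans _ _ (height `^ q * mean mu (K a))).
      rewrite -meanZ//; apply: le_mean.
      - by apply: bmeas_powR; [exact: ltW|exact: bmeas_normc|move=> x; exact: normc_ge0].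
      - by apply: bmeasM => //; exact: bmeas_cst.
      move=> x; rewrite normg powRM ?normc_ge0//; apply: ler_wpM2l; first exact: powR_ge0.
      have := fK a x; have := K1 a x; have := normc_ge0 (f a x).
      move: (Normc.normc _) (K a x) => u k u0 k1 uk; have u1 := le_trans uk k1; apply: le_trans uk.
      have [->|u0'] := eqVneq u 0; first by rewrite powR0// gt_eqF.
      by apply: ge1r_powR => //; rewrite lt_def u0' u0 u1.
    by apply: ler_wpM2l => //; exact: powR_ge0.
  apply: (le_trans (ler_wpM2r (powR_ge0 _ _) hm)).
  rewrite le_eqVlt; apply/orP; left; apply/eqP.
  rewrite /height !powRN.
  have t1 : 2 `^ (n%:R / q) != 0 :> R by rewrite gt_eqF// powR_gt0.
  have t2 : 2 `^ (r * (n + 4 * d.+1)%N%:R) != 0 :> R by rewrite gt_eqF// powR_gt0.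
  have t3 : (B ^ d)%N%:R `^ fine (theta^-1)%E != 0 :> R by rewrite gt_eqF// powR_gt0.
  by field; rewrite t1 t2 t3.
- by case: tF => s _ /funext ->; exact: tpoly_continuous.
- by move=> j; rewrite /F big1// => a _; rewrite /g fxi mulr0.
rewrite cbmeas_Lpnorm//; last exact: (trigp_cbmeas tF).
rewrite lee_fin.
pose S x := Normc.normc (signed_sum e (f ^~ x)).
have bS : bmeas (fun x => S x `^ p).
  apply: bmeas_powR; [exact: ltW| |by move=> x; exact: normc_ge0].
  apply: bmeas_normc; apply: cbmeas_sum => a; apply: cbmeasM => //.
  exact: cbmeas_cst.
have -> : mean mu (fun x => Normc.normc (F x) `^ p) = height `^ p * mean mu (fun x => S x `^ p).
  rewrite -meanZ//; congr mean; apply/funext => x.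
  by rewrite FE Normc.normcM normc_real ger0_norm// powRM// normc_ge0.
have mS0 : 0 <= mean mu (fun x => S x `^ p) by apply: mean_ge0 => x; exact: powR_ge0.
rewrite [leRHS]powRM ?powR_ge0// -powRrM divff ?gt_eqF// powRr1//.
apply: ler_wpM2l => //.
apply: ge0_ler_powR; rewrite ?invr_ge0 ?nnegrE ?(ltW p0)//.
  rewrite !mulr_ge0// ?powR_ge0// ?invr_ge0 ?mulr_ge0 ?exprn_ge0//; exact: ltW.
by move: he; rewrite cardI.
Qed.

End fooling.

Lemma Lp_cst_gt0 (R : realType) d (p : R) : 0 < @Lp_cst R d p.
Proof.
have c0 : 0 < @bump_cst R d.+1 by rewrite invr_gt0 mulr_gt0// exprn_gt0.
by rewrite mulr_gt0// divr_gt0 ?powR_gt0 ?divr_gt0 ?mulr_gt0 ?exprn_gt0.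
Qed.

(** The powers of [2] and of the number [B ^ d] of blocks in the norm of the
    fooling function. *)
Lemma height_Lp (R : realType) (d n B : nat) (p q r : R) (theta : \bar R) :
  (0 < B)%N ->
  @height R d n B q r theta * (@Lp_cst R d p * ((B ^ d)%N%:R * 2^-1 ^+ n)) `^ p^-1
  = @Lp_cst R d p `^ p^-1 * 2 `^ (- (4 * d.+1%:R * r))
    * 2 `^ (- (n%:R * (r - (q^-1 - p^-1))))
    * B%:R `^ (d%:R * (p^-1 - fine (theta^-1)%E)).
Proof.
move=> B0; have L0 := ltW (Lp_cst_gt0 d p).
have B0' : B%:R != 0 :> R by rewrite pnatr_eq0 -lt0n.
have two0 : 2 != 0 :> R by rewrite pnatr_eq0.
have pw (x u v : R) : x != 0 -> x `^ u * x `^ v = x `^ (u + v).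
  by move=> x0; rewrite powRD// x0 implybT.
rewrite /height; set k := fine _; move: (@Lp_cst R d p) L0 => L L0.
rewrite powR_expVn natrX -(powR_mulrn d (ler0n R B)).
rewrite powRM// ?mulr_ge0 ?powR_ge0// powRM ?powR_ge0// -!powRrM.
transitivity (L `^ p^-1
  * (2 `^ (n%:R / q) * 2 `^ (- (r * (n + 4 * d.+1)%N%:R)) * 2 `^ (- n%:R * p^-1))
  * (B%:R `^ (d%:R * - k) * B%:R `^ (d%:R * p^-1))); first by ring.
rewrite -[L `^ p^-1 * _ * 2 `^ _]mulrA !pw//.
congr (_ * 2 `^ _ * _ `^ _); last by ring.
by rewrite natrD natrM; ring.
Qed.

Theorem theorem5p2 (R : realType) (d : nat) (q p r : R) (theta : \bar R)
    (hd : (0 < d)%N) (hq : 1 <= q) (hqp : q < p) (htheta : (1 <= theta)%E)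
    (hr : q^-1 - p^-1 < r) :
  let beta := q^-1 - p^-1 in
  exists2 c : R, 0 < c &
    forall (n m : nat) (xi : 'I_m -> rpoint R d)
        (psi : 'I_m -> rpoint R d -> R[i]),
      (0 < n)%N ->
      (forall j, torus (xi j)) ->
      is_net xi n (n - 1) ->
      (forall j, in_Lp p (psi j)) ->
      ((c * (2 `^ (- (n%:R * (r - beta)))
             * n%:R `^ ((d%:R - 1) * (p^-1 - fine (theta^-1)%E))))%:E
       <= recovery_error xi psi (besov_ball r q theta) p)%E.
Proof.
move=> beta; case: d hd => // d _.
have p0 : 0 < p by rewrite (lt_trans _ hqp)// (lt_le_trans _ hq).
set k := fine (theta^-1)%E; pose E := d%:R * (p^-1 - k).
pose c := @Lp_cst R d p `^ p^-1 * 2 `^ (- (4 * d.+1%:R * r))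
  * (2 * d.+1)%N%:R `^ (- `|E|).
exists c; first by rewrite !mulr_gt0 ?powR_gt0 ?Lp_cst_gt0 ?ltr0n.
move=> n m xi psi n0 _ net _.
(* [B] is comparable to [n], and [d] numbers less than [B] sum up to at most [n] *)
pose B := (n %/ d.+1).+1.
have nd : (n < d.+1 * B)%N by rewrite mulnC ltn_ceil.
have nd' : (d * (n %/ d.+1) <= n)%N.
  by rewrite (leq_trans _ (leq_trunc_div n d.+1))// mulnC leq_mul.
have nd'' : (n %/ d.+1 <= n)%N by exact: leq_div.
have dBn : (d * B <= n + d)%N by rewrite mulnS addnC leq_add2r.
have [F [bF cF F0 LF]] :=
  fooling_function n0 (isT : (0 < B)%N) dBn net r hq p0 htheta.
apply: (@le_trans _ _ (Lpnorm p F)); last first.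
  apply: ereal_sup_ubound; exists F => //.
  congr Lpnorm; apply/funext => x; rewrite /recover big1 ?subr0// => j _.
  by rewrite F0 mul0r.
apply: le_trans LF; rewrite lee_fin height_Lp// -/beta -/k -/E.
have -> : d.+1%:R - 1 = d%:R :> R by rewrite -natr1 addrK.
rewrite -/E /c.
have hE : (2 * d.+1)%N%:R `^ (- `|E|) * n%:R `^ E <= B%:R `^ E.
  apply: powR_comparable; rewrite ?ltr0n// -natrM ler_nat; nia.
move: hE; set u := _ `^ p^-1; set v := 2 `^ _; set w := 2 `^ _ => hE.
have -> a b : u * v * a * (w * b) = u * v * w * (a * b) by ring.
by apply: ler_wpM2l => //; rewrite !mulr_ge0 ?powR_ge0.
Qed.
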